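(* Let $S=\mathbb{C}[x_{10},\ldots,x_{1n_1},\ldots,x_{k0},\ldots,x_{kn_k}]$ and let $I=\langle f_1,\ldots,f_s\rangle\subset S$ be an ideal generated by multihomogeneous polynomials with $\delta<\infty$ solutions in $\mathbb{P}^{n_1}\times\cdots\times\mathbb{P}^{n_k}$, counting multiplicities. Let $\rho\in\mathbb{N}^k$, let $V=S_\rho$, and let $N:V\to\mathbb{C}^\delta$ be a surjective $\mathbb{C}$-linear map with $\ker(N)\subset I_\rho=I\cap V$. Assume that there are nonzero linear forms $h_i=h_{i0}x_{i0}+\cdots+h_{in_i}x_{in_i}\in S_{e_i}$, $i=1,\ldots,k$, such that the map $$N_h:S_{\rho-\mathbf{1}}\to\mathbb{C}^\delta,\qquad f\mapsto N(h_1\cdots h_k\cdot f)$$ is surjective. Let $B\subset S_{\rho-\mathbf{1}}$ be any subspace such that $S_{\rho-\mathbf{1}}=B\oplus\ker(N_h)$. Then: (i) $N^*:=(N_h)_{|B}:B\to\mathbb{C}^\delta$ is invertible; (ii) there is an isomorphism of $\mathbb{C}\left[\frac{x_{11}}{h_1},\ldots,\frac{x_{1n_1}}{h_1},\ldots,\frac{x_{k1}}{h_k},\ldots,\frac{x_{kn_k}}{h_k}\right]$-modules $h_1\cdots h_k\cdot B\simeq S_\rho/I_\rho$; (iii) $V=h_1\cdots h_k\cdot B\oplus (V\cap I)$ and $I=(\langle\ker(N)\rangle:(h_1\cdots h_k)^* )$; (iv) for $i=1,\ldots,k$ and $j=0,\ldots,n_i$, the map $N_{ij}:B\to\mathbb{C}^\delta$,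 $b\mapsto N(h_1\cdots\hat{h}_i\cdots h_k\cdot x_{ij}\cdot b)$, decomposes as $N_{ij}=N^*\circ m_{x_{ij}}$, where the maps $m_{x_{ij}}$ represent the multiplications by $x_{ij}/h_i$ in $h_1\cdots h_k\cdot B$ modulo $I_\rho$ and are commuting.
   Context: The variables $x_{i0},\ldots,x_{in_i}$ are the projective coordinates on the $i$-th factor $\mathbb{P}^{n_i}$. $S$ is graded by $\mathbb{N}^k$ accordingly: for $\rho\in\mathbb{N}^k$, $S_\rho$ is the space of polynomials that are homogeneous of degree $\rho_i$ in $x_{i0},\ldots,x_{in_i}$ for each $i=1,\ldots,k$ (and $S_\rho=0$ if some $\rho_i<0$). $e_i$ is the $i$-th standard basis vector of $\mathbb{Z}^k$ and $\mathbf{1}=\sum_{i=1}^k e_i$. ''$\delta$ solutions counting multiplicities'' means that the subscheme of $\mathbb{P}^{n_1}\times\cdots\times\mathbb{P}^{n_k}$ defined by $I$ is finite of degree $\delta$. The hat in $h_1\cdots\hat{h}_i\cdots h_k$ means that the factor $h_i$ is omitted. $\langle\ker(N)\rangle$ is the ideal of $S$ generated by $\ker(N)$. For an ideal $J\subset S$ and $p\in S$, $(J:p^* )=\{q\in S\mid\exists l\in\mathbb{N}\text{ such that }p^lq\in J\}$. In (iv), $B$ is identified with $h_1\cdots h_k\cdot B$ through $b\mapsto h_1\cdots h_k\cdot b$. That $m_{x_{ij}}$ represents the multiplication by $x_{ij}/h_i$ in $h_1\cdots h_k\cdot B$ modulo $I_\rho$ means that $m_{x_{ij}}$ maps $h_1\cdots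 h_k\cdot b$ (with $b\in B$) to an element of $h_1\cdots h_k\cdot B$ congruent to $h_1\cdots\hat{h}_i\cdots h_k\cdot x_{ij}\cdot b$ modulo $I_\rho$; under the identification, $m_{x_{ij}}:B\to B$ satisfies $h_1\cdots h_k\cdot m_{x_{ij}}(b)\equiv h_1\cdots\hat{h}_i\cdots h_k\cdot x_{ij}\cdot b\mod I_\rho$. In (ii), $\frac{x_{ij}}{h_i}$ acts on $S_\rho/I_\rho$ by sending the class of $h_1\cdots h_k\cdot g$ ($g\in S_{\rho-\mathbf{1}}$) to the class of $h_1\cdots\hat{h}_i\cdots h_k\cdot x_{ij}\cdot g$, and it acts on $h_1\cdots h_k\cdot B$ by sending $h_1\cdots h_k\cdot b$ to the element of $h_1\cdots h_k\cdot B$ congruent to $h_1\cdots\hat{h}_i\cdots h_k\cdot x_{ij}\cdot b$ modulo $I_\rho$.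
   Formalization: In (iii), I=(<ker N>:(h_1...h_k)^* ) fails for non-saturated I (k=1, I=<x0^2,x0x1>, rho=2, N=coefficient of x1^2, h=x1). Proved instead: this colon ideal is the saturation of I by the irrelevant ideal, so it equals I when I is saturated. *)

(* Defs.v *)
From HB Require Import structures.
From mathcomp Require Import all_boot all_order all_algebra.
From mathcomp Require Import boolp reals complex mpoly.

Set Implicit Arguments.
Unset Strict Implicit.
Unset Printing Implicit Defensive.

Import Order.TTheory GRing.Theory Num.Theory.
Local Open Scope ring_scope.
Local Open Scope quotient_scope.

Section MultigradedRing.
Context (C : fieldType) (k : nat) (n : 'I_k -> nat).

(* Factors are numbered from 0 to k-1; the coordinates on the i-th one from 0
   to n_i. The variables of S are indexed by the pairs (i, j). *)
Definition nvars : nat := #|{: {i : 'I_k & 'I_(n i).+1}}|.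
Definition vidx (i : 'I_k) (j : 'I_(n i).+1) : 'I_nvars :=
  enum_rank (Tagged (fun i => 'I_(n i).+1) j).

Definition mring := {mpoly C[nvars]}.
Definition xvar (i : 'I_k) (j : 'I_(n i).+1) : mring := 'X_(vidx j).

Definition mndeg (i : 'I_k) (m : 'X_{1..nvars}) : nat :=
  \sum_(j < (n i).+1) m (vidx j).

(* Degrees range over Z^k, so that S_(rho - 1) is zero as soon as rho has a
   zero entry. *)
Definition mhomog (r : 'I_k -> int) : {pred mring} :=
  [pred p : mring | all (fun m => [forall i, (mndeg i m)%:Z == r i]) (msupp p)].

Lemma mhomogP r p :
  reflect (forall m, m \in msupp p -> forall i, (mndeg i m)%:Z = r i)
          (p \in mhomog r).
Proof.
apply: (iffP allP) => [h m /h /forallP hm i|h m /h hm]; first exact/eqP.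
by apply/forallP => i; apply/eqP.
Qed.

Lemma mhomog_submod_closed r : submod_closed (mhomog r).
Proof.
split=> [|c p q /mhomogP hp /mhomogP hq].
  by apply/mhomogP => m; rewrite msupp0.
apply/mhomogP => m /msuppD_le; rewrite mem_cat => /orP[/msuppZ_le|].
  exact: hp.
exact: hq.
Qed.

HB.instance Definition _ r :=
  GRing.isSubmodClosed.Build C mring (mhomog r) (mhomog_submod_closed r).

Lemma mndegD i m1 m2 : mndeg i (m1 + m2)%MM = (mndeg i m1 + mndeg i m2)%N.
Proof. by rewrite /mndeg -big_split /=; apply: eq_bigr => j _; rewrite mnmDE. Qed.

Lemma mndegU i i' (j : 'I_(n i').+1) :
  mndeg i U_(vidx j)%MM = (i == i') :> nat.
Proof.
rewrite /mndeg; case: (eqVneq i i') => [->|ne].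
  rewrite (bigD1 j) //= mnm1E eqxx big1 // => l nel.
  rewrite mnm1E; case: eqP => // /enum_rank_inj /eqP.
  by rewrite eq_Tagged /= => /eqP e; rewrite e eqxx in nel.
rewrite big1 // => l _; rewrite mnm1E; case: eqP => // /enum_rank_inj e.
by have := congr1 tag e => /= e'; rewrite e' eqxx in ne.
Qed.

Lemma mhomogM r1 r2 r p q : (forall i, r i = r1 i + r2 i) ->
  p \in mhomog r1 -> q \in mhomog r2 -> p * q \in mhomog r.
Proof.
move=> hr /mhomogP hp /mhomogP hq; apply/mhomogP => m.
move=> /msuppM_le /allpairsP[[m1 m2] /= [h1 h2 ->]] i.
by rewrite mndegD PoszD (hp _ h1) (hq _ h2) hr.
Qed.

(* The graded piece S_r. *)
Record Sdeg (r : 'I_k -> int) :=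
  MkSdeg { Sdeg_val :> mring; _ : Sdeg_val \in mhomog r }.

Section Piece.
Variable r : 'I_k -> int.
HB.instance Definition _ := [isSub for @Sdeg_val r].
HB.instance Definition _ := [Choice of Sdeg r by <:].
HB.instance Definition _ := [SubChoice_isSubLmodule of Sdeg r by <:].

Lemma Sdeg_homog (v : Sdeg r) : Sdeg_val v \in mhomog r.
Proof. by case: v. Qed.

(* A monomial of multidegree r has total degree below this bound. *)
Let bnd : nat := (\sum_(i < k) `|r i|%N).+1.

Lemma mdeg_mndeg m : mdeg m = (\sum_(i < k) mndeg i m)%N.
Proof.
rewrite mdegE (reindex (@enum_rank {i : 'I_k & 'I_(n i).+1})) /=; last first.
  by apply: onW_bij; exact: enum_rank_bij.
rewrite /mndeg.
rewrite (@sig_big_dep _ _ _ _ (fun i : 'I_k => 'I_(n i).+1) xpredT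
  (fun _ _ => true) (fun i j => m (vidx j))) /=.
by apply: eq_bigr => -[i j] _.
Qed.

Let T := {m : 'X_{1..nvars < bnd} | [forall i, (mndeg i m)%:Z == r i]}.

Lemma Sdeg_vecaxiom : Vector.axiom #|{: T}| (Sdeg r).
Proof.
pose e (i : 'I_#|{: T}|) : 'X_{1..nvars} := val (val (enum_val i)).
have e_inj : injective e by move=> i j /val_inj/val_inj/enum_val_inj.
have e_deg i : 'X_[e i] \in mhomog r.
  apply/mhomogP => m; rewrite msuppX inE => /eqP -> l.
  by have /forallP /(_ l) /eqP := valP (enum_val i).
pose f (p : Sdeg r) := \row_i (Sdeg_val p)@_(e i).
exists f => [c p q|].
  by apply/rowP => i; rewrite !mxE /= mcoeffD mcoeffZ.
have dg (u : 'rV[C]_#|{: T}|) : \sum_i u 0 i *: 'X_[e i] \in mhomog r.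
  by apply: rpred_sum => i _; apply: rpredZ.
have cE (u : 'rV[C]_#|{: T}|) j : (\sum_i u 0 i *: 'X_[e i])@_(e j) = u 0 j.
  rewrite raddf_sum /= (bigD1 j) //= mcoeffZ mcoeffX eqxx mulr1 big1 ?addr0 //.
  by move=> i ne; rewrite mcoeffZ mcoeffX (inj_eq e_inj) (negbTE ne) mulr0.
exists (fun u => MkSdeg (dg u)) => [p|u]; last first.
  by apply/rowP => j; rewrite mxE /= cE.
apply/val_inj/mpolyP => m /=.
have [hm|hm] := boolP [forall i, (mndeg i m)%:Z == r i].
  have lt : (mdeg m < bnd)%N.
    rewrite ltnS mdeg_mndeg; apply: leq_sum => i _.
    by move/forallP: hm => /(_ i) /eqP <-.
  have hm' : [forall i, (mndeg i (BMultinom lt))%:Z == r i] by [].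
  have <- : e (enum_rank (exist _ (BMultinom lt) hm' : T)) = m.
    by rewrite /e enum_rankK.
  by rewrite cE mxE.
rewrite raddf_sum /= big1 => [|i _].
  apply/esym/eqP; rewrite mcoeff_eq0; apply: contra hm.
  by move=> /(mhomogP _ _ (Sdeg_homog p)) h; apply/forallP => i; apply/eqP.
rewrite mcoeffZ mcoeffX; case: eqP => [em|_]; last by rewrite mulr0.
by case/negP: hm; rewrite -em; exact: (valP (enum_val i)).
Qed.

HB.instance Definition _ := Lmodule_hasFinDim.Build C (Sdeg r) Sdeg_vecaxiom.
End Piece.

Definition dnat (rho : 'I_k -> nat) : 'I_k -> int := fun i => (rho i)%:Z.
Definition dpred (rho : 'I_k -> nat) : 'I_k -> int := fun i => (rho i)%:Z - 1.
Definition dones : 'I_k -> int := fun=> 1.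

Lemma dpredK rho i : dnat rho i = dones i + dpred rho i.
Proof. by rewrite /dpred /dones addrC subrK. Qed.

Definition mul1 (rho : 'I_k -> nat) (q : Sdeg dones) (p : Sdeg (dpred rho)) :
    Sdeg (dnat rho) :=
  MkSdeg (mhomogM (dpredK rho) (Sdeg_homog q) (Sdeg_homog p)).


Lemma mul1_linear rho q : linear (mul1 (rho := rho) q).
Proof. by move=> c u v; apply: val_inj; rewrite /= mulrDr scalerAr. Qed.

HB.instance Definition _ rho q :=
  GRing.isLinear.Build C (Sdeg (dpred rho)) (Sdeg (dnat rho)) *:%R
    (mul1 (rho := rho) q) (mul1_linear q).

Definition mulhom rho (q : Sdeg dones) :
    'Hom(Sdeg (dpred rho), Sdeg (dnat rho)) :=
  linfun (mul1 (rho := rho) q).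

Definition linform (a : forall i, 'rV[C]_(n i).+1) (i : 'I_k) : mring :=
  \sum_(j < (n i).+1) a i 0 j *: xvar j.

Definition dunit (l : 'I_k) : 'I_k -> int := fun i => (i == l)%:Z.

Lemma xvar_homog i (j : 'I_(n i).+1) : xvar j \in mhomog (dunit i).
Proof.
by apply/mhomogP => m; rewrite msuppX inE => /eqP -> l; rewrite mndegU.
Qed.

Lemma linform_homog a i : linform a i \in mhomog (dunit i).
Proof. by apply: rpred_sum => j _; apply: rpredZ; exact: xvar_homog. Qed.

Lemma prod_homog (F : 'I_k -> mring) :
  (forall i, F i \in mhomog (dunit i)) -> \prod_i F i \in mhomog dones.
Proof.
move=> hF; have h (s : seq 'I_k) :
    \prod_(i <- s) F i \in mhomog (fun l => (count_mem l s)%:Z).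
  elim: s => [|i s ih].
    rewrite big_nil; apply/mhomogP => m.
    rewrite msupp1 inE => /eqP -> l.
    by rewrite /mndeg big1 // => j _; rewrite mnm0E.
  rewrite big_cons; apply: mhomogM (hF i) ih => l.
  by rewrite /= PoszD /dunit eq_sym.
apply/mhomogP => m /(mhomogP _ _ (h _)) hm i; rewrite hm.
by rewrite count_uniq_mem ?index_enum_uniq // mem_index_enum.
Qed.

Section Forms.
Variable a : forall i, 'rV[C]_(n i).+1.

(* h_1 ... h_k, where h_i = linform a i *)
Definition hprod : Sdeg dones := MkSdeg (prod_homog (linform_homog a)).

(* h_1 ... x_ij ... h_k, with x_ij in the place of h_i *)
Lemma hxprod_homog i (j : 'I_(n i).+1) :
  xvar j * \prod_(l < k | l != i) linform a l \in mhomog dones.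
Proof.
have := @prod_homog (fun l => if l == i then xvar j else linform a l).
rewrite (bigD1 i) //= eqxx (eq_bigr (linform a)); last first.
  by move=> l /negbTE ->.
by apply=> l; case: eqP => [->|_]; [exact: xvar_homog | exact: linform_homog].
Qed.

Definition hxprod i (j : 'I_(n i).+1) : Sdeg dones := MkSdeg (hxprod_homog j).
End Forms.

Definition ideal_gen (G : mring -> Prop) : mring -> Prop := fun p =>
  exists m (c g : 'I_m -> mring), (forall i, G (g i)) /\ p = \sum_i c i * g i.

Definition colon_star (J : mring -> Prop) (p : mring) : mring -> Prop :=
  fun q => exists l : nat, J (p ^+ l * q).

(* The saturation (I : b^oo) by the irrelevant ideal
   b = <x_10, ..., x_1n_1> ... <x_k0, ..., x_kn_k>; the ideal b^l is generated
   by the polynomials of multidegree (l, ..., l). *)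
Definition saturation (I : mring -> Prop) : mring -> Prop := fun q =>
  exists l : nat, forall p, p \in mhomog (dnat (fun=> l)) -> I (p * q).

(* Points of P^(n_1) x ... x P^(n_k), by homogeneous coordinates. *)
Definition coords := forall i : 'I_k, 'rV[C]_(n i).+1.

Definition is_point (z : coords) : Prop := forall i, z i <> 0.

Definition same_point (z z' : coords) : Prop :=
  forall i, exists2 c : C, c != 0 & z' i = c *: z i.

Definition evalp (z : coords) (p : mring) : C :=
  p.@[fun v => z (tag (enum_val v)) 0 (tagged (enum_val v))].

Definition zero_of (J : mring -> Prop) (z : coords) : Prop :=
  is_point z /\ forall p, J p -> evalp z p = 0.

Definition S_frac := {fraction mring}.
Definition toS_frac : mring -> S_frac := @tofrac mring.
Definition cst (c : C) : S_frac := toS_frac c%:MP.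

(* The fractions a / b, with a in J and b multihomogeneous of the same
   multidegree and b(z) != 0. For J = S this is the local ring of the product
   of projective spaces at z; for J a multihomogeneous ideal it is the ideal
   of the subscheme defined by J in this local ring. *)
Definition local_part (J : mring -> Prop) (z : coords) : S_frac -> Prop :=
  fun x => exists (r : 'I_k -> int) (a b : mring),
    [/\ a \in mhomog r, b \in mhomog r, J a, evalp z b <> 0 &
        x = toS_frac a / toS_frac b].

(* dim_C (U / W) = d *)
Definition quot_dim (U W : S_frac -> Prop) (d : nat) : Prop :=
  exists b : 'I_d -> S_frac, (forall t, U (b t)) /\
    forall x, U x ->
      exists! c : 'rV[C]_d, W (x - \sum_t cst (c 0 t) * b t).

Definition multiplicity (J : mring -> Prop) (z : coords) (d : nat) : Prop :=
  quot_dim (local_part (fun=> True) z) (local_part J z) d.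

(* The subscheme defined by J has finitely many points, and the dimensions of
   its local rings add up to delta. *)
Definition scheme_finite_of_degree (J : mring -> Prop) (delta : nat) : Prop :=
  exists m (z : 'I_m -> coords) (mu : 'I_m -> nat),
    [/\ forall t, zero_of J (z t),
        forall t t', same_point (z t) (z t') -> t = t',
        forall z', zero_of J z' -> exists t, same_point (z t) z',
        forall t, multiplicity J (z t) (mu t) &
        (\sum_t mu t)%N = delta].

Lemma vspace_of_exists (V : vectType C) (P : V -> Prop) :
  P 0 -> (forall c u v, P u -> P v -> P (c *: u + v)) ->
  exists U : {vspace V}, forall v, v \in U <-> P v.
Proof.
move=> P0 Plin.
pose Q d := `[< exists U : {vspace V}, (forall v, v \in U -> P v) /\ \dim U = d >].
have Q0 : exists d, Q d.
  exists 0%N; apply/asboolP; exists 0%VS; split; last exact: dimv0.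
  by move=> v; rewrite memv0 => /eqP ->.
have Qle d : Q d -> (d <= \dim (fullv : {vspace V}))%N.
  by move=> /asboolP[U [_ <-]]; apply: dimvS; exact: subvf.
have [d /asboolP[U [UP Ud]] dmax] := ex_maxnP Q0 Qle.
exists U => v; split; [exact: UP | move=> Pv].
have : (\dim (U + <[v]>) <= d)%N.
  apply: dmax; apply/asboolP; exists (U + <[v]>)%VS; split => // w.
  move=> /memv_addP[u uU [y /vlineP[c ->] ->]].
  by rewrite addrC; apply: Plin => //; exact: UP.
rewrite -Ud => le; have := dimv_leqif_sup (addvSl U <[v]>).
move=> /geq_leqif; rewrite le => /esym h.
by apply: (subvP h); apply: (subvP (addvSr _ _)); exact: memv_line.
Qed.

Section QuotientPiece.
Variables (G : mring -> Prop) (r : 'I_k -> int).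

Lemma ideal_gen0 : ideal_gen G 0.
Proof.
by exists 0%N, (fun=> 0), (fun=> 0); split; [case | rewrite big_ord0].
Qed.

Lemma ideal_gen_lin (c : C) (p q : mring) :
  ideal_gen G p -> ideal_gen G q -> ideal_gen G (c *: p + q).
Proof.
move=> [m [d [g [hg ->]]]] [m' [d' [g' [hg' ->]]]].
exists (m + m')%N, (fun i => match split i with inl j => c *: d j | inr j => d' j end),
  (fun i => match split i with inl j => g j | inr j => g' j end).
split=> [i|]; first by case: split.
rewrite big_split_ord /= scaler_sumr; congr (_ + _).
  by apply: eq_bigr => i _; rewrite (unsplitK (inl i)) scalerAl.
by apply: eq_bigr => i _; rewrite (unsplitK (inr i)).
Qed.

Lemma Ideg_exists :
  exists U : {vspace Sdeg r}, forall v, v \in U <-> ideal_gen G (Sdeg_val v).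
Proof.
apply: vspace_of_exists; first exact: ideal_gen0.
by move=> c u v; exact: ideal_gen_lin.
Qed.

(* I_r = I \cap S_r, as a subspace of S_r, where I is generated by G *)
Definition Ideg : {vspace Sdeg r} := sval (cid Ideg_exists).

Lemma IdegP v : v \in Ideg <-> ideal_gen G (Sdeg_val v).
Proof. by rewrite /Ideg; case: cid. Qed.

(* S_r / I_r *)
Definition Squot := Quotient.quot (pred_of_vspace Ideg).
HB.instance Definition _ := GRing.Zmodule.on Squot.
Definition Sclass : Sdeg r -> Squot := \pi_Squot.
End QuotientPiece.

Section AffineRing.
Variable a : forall i, 'rV[C]_(n i).+1.

Definition xfrac i (j : 'I_(n i).+1) : S_frac :=
  toS_frac (xvar j) / toS_frac (linform a i).

(* The C-subalgebra of the fraction field of S generated by the x_ij / h_i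
   with j != 0. *)
Inductive in_affine : S_frac -> Prop :=
| InCst c : in_affine (cst c)
| InVar i (j : 'I_(n i)) : in_affine (xfrac (lift ord0 j))
| InAdd x y : in_affine x -> in_affine y -> in_affine (x + y)
| InMul x y : in_affine x -> in_affine y -> in_affine (x * y).

Definition affine_pred : {pred S_frac} := [pred x : S_frac | `[< in_affine x >]].

Lemma affine_subring_closed : subring_closed affine_pred.
Proof.
split=> [|x y /asboolP hx /asboolP hy|x y /asboolP hx /asboolP hy].
- by apply/asboolP; have := InCst 1; rewrite /cst /toS_frac !rmorph1.
- apply/asboolP; apply: InAdd => //; rewrite -mulN1r; apply: InMul => //.
  by have := InCst (-1); rewrite /cst /toS_frac !rmorphN1.
- by apply/asboolP; exact: InMul.
Qed.

HB.instance Definition _ :=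
  GRing.isSubringClosed.Build S_frac affine_pred affine_subring_closed.

Record affine_ring :=
  MkAffine { affine_val :> S_frac; _ : affine_val \in affine_pred }.

HB.instance Definition _ := [isSub for affine_val].
HB.instance Definition _ := [Choice of affine_ring by <:].
HB.instance Definition _ := [SubChoice_isSubComNzRing of affine_ring by <:].

Definition affine_cst c : affine_ring := MkAffine (asboolT (InCst c)).
Definition affine_var i (j : 'I_(n i)) : affine_ring :=
  MkAffine (asboolT (InVar j)).
End AffineRing.

Section Maps.
Variables (rho : 'I_k -> nat) (delta : nat).
Variable N : 'Hom(Sdeg (dnat rho), 'rV[C]_delta).
Variable a : forall i, 'rV[C]_(n i).+1.
Variable B : {vspace Sdeg (dpred rho)}.

Definition Nh : 'Hom(Sdeg (dpred rho), 'rV[C]_delta) :=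
  (N \o mulhom rho (hprod a))%VF.

Definition Nstar : 'Hom(subvs_of B, 'rV[C]_delta) := (Nh \o linfun vsval)%VF.

Definition Nij i (j : 'I_(n i).+1) : 'Hom(subvs_of B, 'rV[C]_delta) :=
  (N \o mulhom rho (hxprod a j) \o linfun vsval)%VF.

Definition hB : {vspace Sdeg (dnat rho)} := (mulhom rho (hprod a) @: B)%VS.
End Maps.
End MultigradedRing.

(* act makes the abelian group M a (left) module over A. *)
Definition module_action (A : pzRingType) (M : zmodType) (act : A -> M -> M) :=
  [/\ forall x y u, act x (act y u) = act (x * y) u,
      forall u, act 1 u = u,
      forall x u v, act x (u + v) = act x u + act x v &
      forall x y u, act (x + y) u = act x u + act y u].

(* Main.v *)
Require Import Defs.
From HB Require Import structures.
From mathcomp Require Import all_boot all_order all_algebra.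
From mathcomp Require Import boolp reals complex mpoly.
From mathcomp Require Import ring zify.

Set Implicit Arguments.
Unset Strict Implicit.
Unset Printing Implicit Defensive.

Import Order.TTheory GRing.Theory Num.Theory.
Local Open Scope ring_scope.

(** Write K for the ideal generated by ker N, and h for h_1 ... h_k. The theorem
    rests on two facts about powers of h.

    Spanning ([hpow_span]): every p of degree rho + m.1 is congruent to some
    h^m g modulo K, with g of degree rho. Surjectivity of N_h says that S_rho is
    h S_(rho-1) + ker N; multiplying by forms of degree (m,...,m) and iterating
    gives the claim.

    Injectivity ([hpow_inj]): if g has degree rho and h^m g lies in I, then g
    lies in ker N. This is where the degree of the scheme enters. In all large
    degrees sigma there are delta elements of S_sigma that are linearly
    independent modulo I ([independent_family]). For sigma = rho + m.1 they are,
    by spanning, congruent to delta elements h^m w_t, so that the vectors N w_t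
    are independent in C^delta, hence a basis. Subtracting from g a combination
    of the w_t leaves an element of ker N, and independence modulo I makes that
    combination zero.

    The independent elements come from the local rings O_z of the product of
    projective spaces at the solutions z. As O_z modulo
    J_z has finite dimension, the maximal ideal is nilpotent modulo J_z
    ([maximal_ideal_nilpotent]). Inverting 1 - y by a finite geometric sum then
    shows that every element of O_z is congruent to p / q with q a power
    product of coordinates nonzero at z ([chart_approx]), and a high power of a
    form vanishing at another solution is zero in the local quotient there, so
    that the approximations can be made at all the solutions at once
    ([simultaneous_approx]). A basis of each local quotient thus lifts to forms
    of a common large degree.

    Everything else follows formally. Injectivity for m = 0 is I_rho = ker N
    ([Irho_ker]), which gives (i) and the direct sum decomposition. An element of
    I times a power of h falls into a degree rho + m.1, where spanning and
    injectivity put it in K; this is the colon formula ([saturation_colon]). The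
    operators of (iv) commute because both products, multiplied by h^2, are
    congruent modulo I to the same polynomial, and h can be cancelled. For (ii), a
    fraction P / h^m sends g to the g' with h^m g' congruent to P g modulo I:
    spanning provides g', injectivity its uniqueness modulo I_rho. *)

(** * Ideals and multihomogeneous polynomials *)

Section Graded.
Context (C : fieldType) (k : nat) (n : 'I_k -> nat).
Local Notation S := (mring C n).
Implicit Types (r : 'I_k -> nat) (p q : S) (J : S -> Prop).

Definition is_ideal J :=
  [/\ J 0, forall p q, J p -> J q -> J (p + q) & forall c p, J p -> J (c * p)].

Lemma is_ideal_sum J (T : finType) (F : T -> S) :
  is_ideal J -> (forall t, J (F t)) -> J (\sum_t F t).
Proof. by move=> [J0 JD _] JF; apply: (big_ind J) => // t _; exact: JF. Qed.

Lemma is_ideal_sub J p q : is_ideal J -> J p -> J q -> J (p - q).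
Proof. by move=> [_ JD JM] Jp Jq; rewrite -mulN1r; apply/JD/JM. Qed.

Lemma ideal_gen_is_ideal G : is_ideal (@ideal_gen C k n G).
Proof.
split; first exact: ideal_gen0.
  by move=> p q Gp Gq; rewrite -[p]scale1r; exact: ideal_gen_lin.
move=> c p [m [d [g [Gg ->]]]]; exists m, (fun i => c * d i), g; split=> //.
by rewrite mulr_sumr; apply: eq_bigr => i _; rewrite mulrA.
Qed.

Lemma ideal_gen_mem (G : S -> Prop) p : G p -> ideal_gen G p.
Proof.
by move=> Gp; exists 1%N, (fun=> 1), (fun=> p); rewrite big_ord1 mul1r.
Qed.

Lemma ideal_gen_min (G J : S -> Prop) :
  is_ideal J -> (forall p, G p -> J p) -> forall p, ideal_gen G p -> J p.
Proof.
move=> JI GJ p [m [d [g [Gg ->]]]]; apply: is_ideal_sum => // i.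
by case: JI => _ _ JM; apply/JM/GJ.
Qed.

Lemma mhomog_eq (r r' : 'I_k -> int) p :
  (forall i, r i = r' i) -> p \in mhomog r -> p \in mhomog r'.
Proof. by move=> /funext ->. Qed.

Lemma mhomogX (r : 'I_k -> int) p m :
  p \in mhomog r -> p ^+ m \in mhomog (fun i => r i *+ m).
Proof.
move=> hp; elim: m => [|m ih].
  apply/mhomogP => m; rewrite expr0 msupp1 inE => /eqP -> l.
  by rewrite /mndeg big1 // => j _; rewrite mnm0E.
by rewrite exprS; apply: mhomogM hp ih => i; rewrite mulrS.
Qed.

Lemma mhomogC (c : C) : c%:MP \in @mhomog C k n (fun=> 0).
Proof.
have := @mhomogX (fun=> 0) 0 0.
rewrite rpred0 expr0 => /(_ isT) h; rewrite -[c%:MP]mulr1 mul_mpolyC.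
by apply: rpredZ; apply: mhomog_eq h => i; rewrite mul0rn.
Qed.

Lemma mnm_divisor r (m : 'X_{1..nvars n}) :
  (forall i, r i <= mndeg i m)%N ->
  exists2 m', (m' <= m)%MM & forall i, mndeg i m' = r i.
Proof.
have [N] := ubnP (mdeg m); elim: N => // N ih in m * => lt le.
have [/forallP eq|] := boolP [forall i, mndeg i m == r i].
  by exists m => [|i]; [exact: lepm_refl | exact/eqP].
rewrite negb_forall => /existsP[i ne].
have gt : (r i < mndeg i m)%N by rewrite ltn_neqAle eq_sym ne le.
have [j m_gt0] : exists j : 'I_(n i).+1, m (vidx j) != 0%N.
  apply/existsP; apply: contraLR gt => /existsPn m0.
  by rewrite -leqNgt /mndeg big1 // => j _; apply/eqP/negPn/m0.
have leU : (U_(vidx j) <= m)%MM by rewrite lep1mP.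
have mE := submK leU.
have [||m' le' deg'] := ih (m - U_(vidx j))%MM.
- by move: lt; rewrite -{1}mE mdegD mdeg1 addn1.
- move=> l; have := le l; rewrite -{1}mE mndegD mndegU.
  case: eqVneq => [->|_]; last by rewrite addn0.
  by have := gt; rewrite -{1}mE mndegD mndegU eqxx addn1.
by exists m' => //; apply: lepm_trans le' _; rewrite lem_subr.
Qed.

(** Since every monomial of degree r1 + r2 has a divisor of degree r2, the
    products of forms of degrees r1 and r2 span S_(r1 + r2); this is the
    corresponding induction principle. *)
Lemma mhomog_mul_ind (Q : S -> Prop) r1 r2 (r : 'I_k -> int) :
  (forall i, r i = (r1 i + r2 i)%N) ->
  Q 0 -> (forall p q, Q p -> Q q -> Q (p + q)) ->
  (forall p q, p \in mhomog (dnat r1) -> q \in mhomog (dnat r2) -> Q (p * q)) ->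
  forall p, p \in mhomog r -> Q p.
Proof.
move=> rE Q0 QD QM p /mhomogP hp; rewrite (mpolyE p) big_seq.
apply: big_ind => // m /hp deg_m.
have degN i : mndeg i m = (r1 i + r2 i)%N by have := deg_m i; rewrite rE => -[].
have [|m' le deg'] := @mnm_divisor r2 m.
  by move=> i; rewrite degN leq_addl.
rewrite -(submK le) mpolyXD scalerAl; apply: QM.
  apply/rpredZ/mhomogP => _ /[!msuppX] /[!inE] /eqP -> i.
  by congr Posz; apply: (@addIn (r2 i)); rewrite -{1}deg' -mndegD submK.
by apply/mhomogP => _ /[!msuppX] /[!inE] /eqP -> i; rewrite deg'.
Qed.

End Graded.

(** * Local rings of the product of projective spaces *)
Section LocalRing.
Context (C : fieldType) (k : nat) (n : 'I_k -> nat).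
Local Notation S := (mring C n).
Implicit Types (z : coords C n) (r : 'I_k -> nat) (p q : S) (J : S -> Prop).
Implicit Types (x y : S_frac C n).

HB.instance Definition _ :=
  GRing.RMorphism.copy (@toS_frac C k n) (@tofrac (mring C n)).
HB.instance Definition _ :=
  GRing.RMorphism.copy (@cst C k n) (@toS_frac C k n \o @mpolyC _ _).
HB.instance Definition _ z :=
  GRing.RMorphism.copy (@evalp C k n z)
    (meval (fun v => z (tag (enum_val v)) 0 (tagged (enum_val v)))).

Definition local_ring z := local_part (fun _ : S => True) z.
Definition maximal_ideal z := local_part (fun p : S => evalp z p = 0) z.

Lemma is_idealT : is_ideal (fun _ : S => True). Proof. by []. Qed.

Lemma is_ideal_evalp z : is_ideal (fun p : S => evalp z p = 0).
Proof.
split=> [|p q p0 q0|c p p0]; first exact: rmorph0.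
  by rewrite rmorphD /= p0 q0 addr0.
by rewrite rmorphM /= p0 mulr0.
Qed.

Lemma toS_frac_neq0 p : p != 0 -> toS_frac p != 0.
Proof. by rewrite /toS_frac tofrac_eq0. Qed.

Lemma evalp_neq0 z p : evalp z p <> 0 -> p != 0.
Proof. by move=> pz; apply/eqP => p0; apply: pz; rewrite p0 rmorph0. Qed.

Lemma local_ringP J z x : local_part J z x -> local_ring z x.
Proof. by move=> [r [a [b [ha hb _ hz ->]]]]; exists r, a, b. Qed.

Lemma local_partD J z x y :
  is_ideal J -> local_part J z x -> local_part J z y -> local_part J z (x + y).
Proof.
move=> [_ JD JM] [r [a [b [ha hb Ja bz ->]]]] [r' [a' [b' [ha' hb' Ja' bz' ->]]]].
exists (fun i => r i + r' i), (a * b' + a' * b), (b * b'); split.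
- by apply: rpredD; [exact: mhomogM ha hb'|apply: mhomogM ha' hb => i; rewrite addrC].
- exact: mhomogM hb hb'.
- by apply: JD; [rewrite mulrC|rewrite mulrC]; exact: JM.
- by rewrite rmorphM; apply/eqP; rewrite mulf_neq0 //; exact/eqP.
- by rewrite addf_div ?toS_frac_neq0 ?(evalp_neq0 bz) ?(evalp_neq0 bz') //
    rmorphD !rmorphM.
Qed.

Lemma local_partM J z x y :
  is_ideal J -> local_ring z x -> local_part J z y -> local_part J z (x * y).
Proof.
move=> [_ JD JM] [r [a [b [ha hb _ bz ->]]]] [r' [a' [b' [ha' hb' Ja' bz' ->]]]].
exists (fun i => r i + r' i), (a * a'), (b * b'); split.
- exact: mhomogM ha ha'.
- exact: mhomogM hb hb'.
- exact: JM.
- by rewrite rmorphM; apply/eqP; rewrite mulf_neq0 //; exact/eqP.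
- by rewrite mulf_div !rmorphM.
Qed.

Lemma local_ring_cst z c : local_ring z (cst n c).
Proof.
exists (fun=> 0), c%:MP, 1; split=> //; try exact: mhomogC.
  by rewrite rmorph1; apply/eqP; exact: oner_neq0.
by rewrite rmorph1 divr1.
Qed.

Lemma local_part0 J z : is_ideal J -> local_part J z 0.
Proof.
move=> [J0 _ _]; exists (fun=> 0), 0, 1; split=> //.
- exact: rpred0.
- exact: mhomogC.
- by rewrite rmorph1; apply/eqP; exact: oner_neq0.
- by rewrite rmorph0 mul0r.
Qed.

Lemma local_partN J z x : is_ideal J -> local_part J z x -> local_part J z (- x).
Proof.
move=> JI Jx; rewrite -mulN1r -(rmorphN1 (@cst C k n)).
exact: local_partM (local_ring_cst _ _) Jx.
Qed.

Lemma local_part_sum J z (T : finType) (F : T -> S_frac C n) :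
  is_ideal J -> (forall t, local_part J z (F t)) -> local_part J z (\sum_t F t).
Proof.
move=> JI JF; apply: big_ind => [|x y|t _]; last exact: JF.
  exact: local_part0.
exact: local_partD.
Qed.

Lemma local_ringX z x m : local_ring z x -> local_ring z (x ^+ m).
Proof.
move=> Ox; elim: m => [|m ih]; last by rewrite exprS; exact: local_partM.
by rewrite expr0 -(rmorph1 (@cst C k n)); exact: local_ring_cst.
Qed.

Lemma local_ring_frac z (r : 'I_k -> int) p q :
  p \in mhomog r -> q \in mhomog r -> evalp z q <> 0 ->
  local_ring z (toS_frac p / toS_frac q).
Proof. by move=> *; exists r, p, q. Qed.

(** For x = a / b the inverse is b / (c b + a), and c b + a takes the value
    c b(z) at z. *)
Lemma local_ring_unit z c x :
  c != 0 -> maximal_ideal z x ->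
  cst n c + x != 0 /\ local_ring z (cst n c + x)^-1.
Proof.
move=> c0 [r [a [b [ha hb az bz ->]]]].
have bF : toS_frac b != 0 by rewrite toS_frac_neq0 ?(evalp_neq0 bz).
have -> : cst n c + toS_frac a / toS_frac b
    = toS_frac (c%:MP * b + a) / toS_frac b.
  by rewrite rmorphD rmorphM mulrDl mulfK.
have nz : evalp z (c%:MP * b + a) <> 0.
  rewrite rmorphD rmorphM /= az addr0 /evalp mevalC.
  by apply/eqP; rewrite mulf_neq0 //; exact/eqP.
have nF : toS_frac (c%:MP * b + a) != 0 by rewrite toS_frac_neq0 ?(evalp_neq0 nz).
split; first exact: mulf_neq0 nF (invr_neq0 bF).
rewrite invf_div; apply: local_ring_frac nz => //; first exact: hb.
by rewrite mul_mpolyC; apply: rpredD ha; exact: rpredZ.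
Qed.

(** Finite colength makes the maximal ideal nilpotent: the powers of [y] are
    linearly dependent modulo [J], and the lowest-order term of a polynomial
    relation is a power of [y] times a unit. *)
Lemma maximal_ideal_nilpotent J z d y :
  is_ideal J -> multiplicity J z d -> maximal_ideal z y ->
  exists e, local_part J z (y ^+ e).
Proof.
move=> JI [b [_ bP]] My; have Oy := local_ringP My.
pose ev (q : {poly C}) := (map_poly (@cst C k n) q).[y].
(* The extra factor y^e absorbs the powers of y split off from q. *)
have rel (q : {poly C}) e : q != 0 -> local_part J z (y ^+ e * ev q) ->
    exists e', local_part J z (y ^+ e').
  elim/poly_ind: q e => [|q c ih] e; first by rewrite eqxx.
  move=> q0; rewrite /ev rmorphD rmorphM /= map_polyX map_polyC hornerMXaddC /=.
  have [c0|c0] := eqVneq c 0.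
    rewrite c0 rmorph0 addr0 (mulrC _ y) mulrA -exprSr; apply: ih.
    by apply: contraNneq q0 => ->; rewrite c0 mul0r addr0.
  rewrite addrC; have Mq : maximal_ideal z (ev q * y).
    apply: local_partM My; first exact: is_ideal_evalp.
    rewrite /ev horner_coef; apply: local_part_sum; first exact: is_idealT.
    move=> i; rewrite coef_map; apply: local_partM (local_ringX _ Oy) => //.
    exact: local_ring_cst.
  have [nz Ou] := local_ring_unit c0 Mq; move/(local_partM JI Ou) => h.
  by exists e; rewrite mulrCA mulVf ?mulr1 // in h.
have /choice[c cP] (i : nat) :
    exists c : 'rV[C]_d, local_part J z (y ^+ i - \sum_t cst n (c 0 t) * b t).
  by have [c [hc _]] := bP _ (local_ringX i Oy); exists c.
pose A := \matrix_(i < d.+1) c i.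
(* The coordinates of the d + 1 powers 1, ..., y^d are linearly dependent. *)
have [u u0 uA] : exists2 u : 'rV_d.+1, u != 0 & u *m A = 0.
  have /rowV0Pn[u /sub_kermxP uA u0] : kermx A != 0; last by exists u.
  by rewrite kermx_eq0 -row_leq_rank -ltnNge ltnS rank_leq_col.
apply: (rel (rVpoly u) 0%N).
  by apply: contraNneq u0 => p0; rewrite -[u]rVpolyK p0 linear0.
rewrite expr0 mul1r /ev (@horner_coef_wide _ d.+1); last first.
  by rewrite size_map_poly size_poly.
have -> : \sum_(i < d.+1) (map_poly (@cst C k n) (rVpoly u))`_i * y ^+ i
    = \sum_(i < d.+1) cst n (u 0 i) * (y ^+ i - \sum_t cst n (c i 0 t) * b t).
  under [RHS]eq_bigr do rewrite mulrBr mulr_sumr.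
  rewrite sumrB exchange_big /= [X in _ - X]big1 ?subr0.
    by apply: eq_bigr => i _; rewrite coef_map coef_rVpoly_ord.
  move=> t _; under eq_bigr do rewrite mulrA -rmorphM.
  rewrite -mulr_suml -rmorph_sum /=.
  have /rowP/(_ t) := uA; rewrite !mxE => e; rewrite -[RHS](mul0r (b t)).
  congr (_ * _); transitivity (cst n (0 : C)); last exact: rmorph0.
  by congr (cst n _); rewrite -[RHS]e; apply: eq_bigr => i _; rewrite mxE.
apply: local_part_sum => // i; apply: local_partM (cP i) => //.
exact: local_ring_cst.
Qed.

End LocalRing.
(** * Lifting the local quotients to forms of large degree *)

Section Charts.
Context (C : fieldType) (k : nat) (n : 'I_k -> nat).
Local Notation S := (mring C n).
Implicit Types (z : coords C n) (r : 'I_k -> nat) (p q : S) (J : S -> Prop).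
Implicit Types (x y : S_frac C n).
Implicit Types (j : forall i : 'I_k, 'I_(n i).+1).

(** The product of the powers L_i^(r_i); when each L_i is a linear form in the
    variables of the i-th factor, this is a form of degree r. *)
Definition form_pow (L : 'I_k -> S) r : S := \prod_i L i ^+ r i.

(** The choice [j] of one coordinate on each factor gives a monomial of every
    degree, nonzero at the points where none of these coordinates vanishes. *)
Definition pivot j r := form_pow (fun i => xvar C (j i)) r.

Definition dehom j r p : S_frac C n := toS_frac p / toS_frac (pivot j r).

Lemma mhomog_prod (F : 'I_k -> S) (d : 'I_k -> 'I_k -> int) :
  (forall i, F i \in mhomog (d i)) ->
  \prod_i F i \in mhomog (fun l => \sum_i d i l).
Proof.
move=> hF; elim: (index_enum _) => [|i s ih].
  have h : (1 : S) \in mhomog (fun=> 0) by exact: mhomogC.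
  by rewrite big_nil; apply: mhomog_eq h => l; rewrite big_nil.
by rewrite big_cons; apply: mhomogM (hF i) ih => l; exact: big_cons.
Qed.

Lemma mhomog_natX r p e :
  p \in mhomog (dnat r) -> p ^+ e \in mhomog (dnat (fun i => r i * e)%N).
Proof.
move=> hp; apply: mhomog_eq (mhomogX e hp) => i.
by rewrite /dnat PoszM -[in RHS](natz e) mulr_natr.
Qed.

Lemma mhomogMn r r' p q :
  p \in mhomog (dnat r) -> q \in mhomog (dnat r') ->
  p * q \in mhomog (dnat (fun i => r i + r' i)%N).
Proof. by apply: mhomogM => i; rewrite /dnat PoszD. Qed.

Lemma form_pow_homog L r :
  (forall i, L i \in mhomog (dunit i)) -> form_pow L r \in mhomog (dnat r).
Proof.
move=> hL; apply: mhomog_eq (mhomog_prod (fun i => mhomogX (r i) (hL i))) => l.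
rewrite (bigD1 l) //= /dunit eqxx big1 ?addr0 => [|i ne].
  by rewrite /dnat natz.
by rewrite eq_sym (negbTE ne) mul0rn.
Qed.

Lemma form_powD L r r' :
  form_pow L (fun i => r i + r' i)%N = form_pow L r * form_pow L r'.
Proof. by rewrite /form_pow -big_split; apply: eq_bigr => i _; rewrite exprD. Qed.

Lemma form_powX L r e : form_pow L (fun i => r i * e)%N = form_pow L r ^+ e.
Proof. by rewrite /form_pow -prodrXl; apply: eq_bigr => i _; rewrite exprM. Qed.

Lemma pivot_homog j r : pivot j r \in mhomog (dnat r).
Proof. by apply: form_pow_homog => i; exact: xvar_homog. Qed.

Lemma pivot0 j : pivot j (fun=> 0%N) = 1.
Proof. by rewrite /pivot /form_pow big1. Qed.

Lemma evalp_xvar z i (l : 'I_(n i).+1) : evalp z (xvar C l) = z i 0 l.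
Proof. by rewrite /evalp /xvar mevalXU /vidx enum_rankK. Qed.

Lemma pivot_exists z : is_point z -> exists j, forall i, z i 0 (j i) != 0.
Proof.
move=> hz; have /fin_all_exists[j jP] i : exists l, z i 0 l != 0.
  by apply/rV0Pn/eqP/hz.
by exists j.
Qed.

Lemma pivot_evalp_neq0 z j r :
  (forall i, z i 0 (j i) != 0) -> evalp z (pivot j r) <> 0.
Proof.
move=> zj; rewrite /pivot /form_pow rmorph_prod; apply/eqP/prodf_neq0 => i _.
by rewrite rmorphXn /= evalp_xvar expf_neq0.
Qed.

Lemma pivot_neq0 j r : toS_frac (pivot j r) != 0.
Proof.
apply: toS_frac_neq0; apply/prodf_neq0 => i _; apply: expf_neq0.
by rewrite -msupp_eq0 msuppX.
Qed.

Lemma dehomM j r r' p q :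
  dehom j (fun i => r i + r' i)%N (p * q) = dehom j r p * dehom j r' q.
Proof. by rewrite /dehom /pivot form_powD !rmorphM mulf_div. Qed.

Lemma dehomX j r p e : dehom j (fun i => r i * e)%N (p ^+ e) = dehom j r p ^+ e.
Proof. by rewrite /dehom /pivot form_powX !rmorphXn expr_div_n. Qed.

Lemma dehom_pivot j r : dehom j r (pivot j r) = 1.
Proof. by rewrite /dehom divff ?pivot_neq0. Qed.

Lemma dehom_local z j r p J : (forall i, z i 0 (j i) != 0) ->
  p \in mhomog (dnat r) -> J p -> local_part J z (dehom j r p).
Proof.
move=> zj hp Jp; exists (dnat r), p, (pivot j r); split=> //.
  exact: pivot_homog.
exact: pivot_evalp_neq0.
Qed.

(** The coordinate ring of the affine chart where the chosen coordinates are
    nonzero, inside the fraction field of S. *)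
Definition in_chart j x :=
  exists r p, p \in mhomog (dnat r) /\ x = dehom j r p.

Lemma in_chartM j x y : in_chart j x -> in_chart j y -> in_chart j (x * y).
Proof.
move=> [r [p [hp ->]]] [r' [q [hq ->]]].
by exists (fun i => r i + r' i)%N, (p * q); rewrite dehomM mhomogMn.
Qed.

Lemma in_chartD j x y : in_chart j x -> in_chart j y -> in_chart j (x + y).
Proof.
move=> [r [p [hp ->]]] [r' [q [hq ->]]].
exists (fun i => r i + r' i)%N, (p * pivot j r' + pivot j r * q); split.
  by apply: rpredD; apply: mhomogMn => //; exact: pivot_homog.
rewrite /dehom rmorphD mulrDl -!/(dehom _ _ _) !dehomM !dehom_pivot.
by rewrite mulr1 mul1r.
Qed.

Lemma in_chart_cst j c : in_chart j (cst n c).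
Proof.
by exists (fun=> 0%N), c%:MP; rewrite /dehom pivot0 rmorph1 divr1; split=> //;
  exact: mhomogC.
Qed.

Lemma in_chartX j x e : in_chart j x -> in_chart j (x ^+ e).
Proof.
move=> hx; elim: e => [|e ih]; last by rewrite exprS; exact: in_chartM.
by rewrite expr0 -(rmorph1 (@cst C k n)); exact: in_chart_cst.
Qed.

(** Modulo J the local ring is already covered by the coordinate ring of a
    chart. If x = a / b, then b is c (1 - y) times the pivot q of the same
    degree, with c = b(z) / q(z) and y in the maximal ideal. As y^e vanishes
    modulo J for some e, the sum of the y^i for i < e is an inverse of 1 - y, and
    x is congruent to the product of a / (c q) with this sum. *)
Lemma chart_approx J z d j x :
  is_ideal J -> multiplicity J z d -> (forall i, z i 0 (j i) != 0) ->
  local_ring z x -> exists2 y, in_chart j y & local_part J z (y - x).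
Proof.
move=> JI mult zj Ox; have := Ox; move=> [ri [a [b [ha hb _ bz xE]]]].
have [r rE] : exists r, forall i, ri i = r i.
  have : msupp b != [::] by rewrite msupp_eq0 (evalp_neq0 bz).
  case E : (msupp b) => [//|m s] _; exists (fun i => mndeg i m) => i.
  by rewrite (mhomogP _ _ hb m) // E mem_head.
have {}ha := mhomog_eq (r' := dnat r) rE ha.
have {}hb := mhomog_eq (r' := dnat r) rE hb.
pose c := evalp z b / evalp z (pivot j r).
have /eqP piz := pivot_evalp_neq0 (r := r) zj.
have c0 : c != 0 by rewrite mulf_neq0 ?invr_eq0 //; exact/eqP.
pose g := pivot j r - c^-1 *: b.
have hg : g \in mhomog (dnat r).
  by apply: rpredB (pivot_homog _ _) _; exact: rpredZ.
have gz : evalp z g = 0.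
  rewrite /g rmorphB /= /evalp mevalZ -!/(evalp _ _) /c invf_div.
  by rewrite divfK ?subrr //; exact/eqP.
have [e Je] := maximal_ideal_nilpotent JI mult (dehom_local zj hg gz).
set y := dehom j r g in Je.
have yE : x * (1 - y) = cst n c^-1 * dehom j r a.
  rewrite /y /dehom /g -mul_mpolyC rmorphB rmorphM mulrBl divff ?pivot_neq0 //.
  rewrite opprB addrC subrK xE -!/(cst _ _).
  have bF : toS_frac b != 0 by rewrite toS_frac_neq0 ?(evalp_neq0 bz).
  have cancel (F : fieldType) (u v w t : F) :
      v != 0 -> t != 0 -> u / v * (w * v / t) = w * (u / t).
    by move=> v0 t0; field; rewrite v0 t0.
  exact: cancel bF (pivot_neq0 _ _).
exists (x * (1 - y) * \sum_(i < e) y ^+ i).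
  rewrite yE; apply: in_chartM.
    by apply: in_chartM; [exact: in_chart_cst | exists r, a].
  have yC : in_chart j y by exists r, g.
  apply: big_ind => [|u v|i _]; last exact: in_chartX.
    by rewrite -(rmorph0 (@cst C k n)); exact: in_chart_cst.
  exact: in_chartD.
have -> : x * (1 - y) * (\sum_(i < e) y ^+ i) - x = - (x * y ^+ e).
  rewrite -mulrA -[1 - y]opprB mulNr -subrX1 mulrN mulrBr mulr1.
  by rewrite opprB addrAC subrr add0r.
by apply: local_partN => //; exact: local_partM.
Qed.

(** Two nonproportional vectors have a nonzero 2 x 2 minor; freezing the second
    vector in this minor gives the form. *)
Lemma separating_form z z' : is_point z -> is_point z' -> ~ same_point z z' ->
  exists r p, [/\ p \in mhomog (dnat r), evalp z' p = 0 & evalp z p <> 0].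
Proof.
move=> hz hz' ns.
have [i [l [l' ne]]] : exists i (l l' : 'I_(n i).+1),
    z i 0 l * z' i 0 l' - z i 0 l' * z' i 0 l <> 0.
  apply: contrapT => h; apply: ns => i.
  have prop l l' : z i 0 l * z' i 0 l' = z i 0 l' * z' i 0 l.
    by apply/subr0_eq; apply: contrapT => ne; apply: h; exists i, l, l'.
  have /rV0Pn[l zl] : z i != 0 by exact/eqP/hz.
  have zE : z' i = (z' i 0 l / z i 0 l) *: z i.
    apply/rowP => l'; rewrite mxE mulrAC -[_ * z i 0 l']mulrC -prop mulrC.
    by rewrite mulKf.
  exists (z' i 0 l / z i 0 l) => //.
  by apply/eqP => c0; apply: (hz' i); rewrite zE c0 scale0r.
exists (fun l => (l == i) : nat), (z' i 0 l' *: xvar C l - z' i 0 l *: xvar C l').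
have eE w : evalp w (z' i 0 l' *: xvar C l - z' i 0 l *: xvar C l')
    = w i 0 l * z' i 0 l' - w i 0 l' * z' i 0 l.
  rewrite rmorphB /= /evalp !mevalZ -!/(evalp _ _) !evalp_xvar.
  by rewrite mulrC [X in _ - X]mulrC.
split; last by rewrite eE.
  by apply: rpredB; apply: rpredZ; exact: xvar_homog.
by rewrite eE mulrC subrr.
Qed.

Section Points.
Context (J : S -> Prop) (M : nat) (z : 'I_M -> coords C n) (mu : 'I_M -> nat).
Context (j : 'I_M -> forall i, 'I_(n i).+1).
Hypothesis JI : is_ideal J.
Hypothesis zP : forall t, is_point (z t).
Hypothesis zj : forall t i, z t i 0 (j t i) != 0.
Hypothesis z_inj : forall t t', same_point (z t) (z t') -> t = t'.
Hypothesis z_mult : forall t, multiplicity J (z t) (mu t).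

(** The product, over the other points t', of a form vanishing at t' but not at
    t, raised to a power that is zero in the local quotient at t'. *)
Lemma separator t : exists r p, [/\ p \in mhomog (dnat r), evalp (z t) p <> 0 &
  forall t', t' != t -> local_part J (z t') (dehom (j t') r p)].
Proof.
suff /(_ (enum 'I_M))[r [p [hp pz sep]]] : forall s : seq 'I_M, exists r p,
    [/\ p \in mhomog (dnat r), evalp (z t) p <> 0 &
     forall t', t' \in s -> t' != t -> local_part J (z t') (dehom (j t') r p)].
  by exists r, p; split=> // t'; apply: sep; rewrite mem_enum.
elim=> [|u s [r [p [hp pz sep]]]].
  exists (fun=> 0%N), 1; split=> //; first exact: mhomogC.
  by rewrite rmorph1; apply/eqP; exact: oner_neq0.
have [->|ut] := eqVneq u t.
  exists r, p; split=> // t'; rewrite inE => /orP[/eqP ->|]; last exact: sep.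
  by rewrite eqxx.
have [|r' [w [hw wu wt]]] := @separating_form _ _ (@zP t) (@zP u).
  by move=> /z_inj e; rewrite e eqxx in ut.
have [e Je] := maximal_ideal_nilpotent JI (z_mult u) (dehom_local (zj u) hw wu).
exists (fun i => r i + r' i * e)%N, (p * w ^+ e); split.
- by apply: mhomogMn => //; exact: mhomog_natX.
- rewrite rmorphM rmorphXn /=; apply/eqP; rewrite mulf_neq0 //; first exact/eqP.
  by apply: expf_neq0; exact/eqP.
- move=> t'; rewrite inE dehomM dehomX => /orP[/eqP -> _|t's t't].
    by apply: local_partM => //; exact: dehom_local.
  rewrite mulrC; apply: local_partM => //; last exact: sep.
  by apply: local_ringX; exact: dehom_local.
Qed.

(** First approximate x divided by the separator p in the chart at t, then
    multiply by p: this restores x at t and gives zero at the other points.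
    Larger degrees are reached by multiplying by a pivot monomial at t, whose
    dehomogenization there is 1. *)
Lemma simultaneous_approx t x : local_ring (z t) x ->
  exists r, forall s, (forall i, r i <= s i)%N -> exists p,
    [/\ p \in mhomog (dnat s), local_part J (z t) (dehom (j t) s p - x) &
     forall t', t' != t -> local_part J (z t') (dehom (j t') s p)].
Proof.
move=> Ox; have [r [p [hp pz sep]]] := separator t.
have pF : toS_frac p != 0 by rewrite toS_frac_neq0 ?(evalp_neq0 pz).
have Ou : local_ring (z t) (toS_frac (pivot (j t) r) / toS_frac p).
  exact: local_ring_frac (pivot_homog _ _) hp pz.
have [_ [r' [q [hq ->]]] Jq] :=
  chart_approx JI (z_mult t) (zj t) (local_partM (is_idealT C n) Ox Ou).
have Jpq : local_part J (z t) (dehom (j t) r p * dehom (j t) r' q - x).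
  have -> : dehom (j t) r p * dehom (j t) r' q - x = dehom (j t) r p *
      (dehom (j t) r' q - x * (toS_frac (pivot (j t) r) / toS_frac p)).
    have -> : toS_frac (pivot (j t) r) / toS_frac p = (dehom (j t) r p)^-1.
      by rewrite /dehom invf_div.
    have cancel (A : fieldType) (u v w : A) :
        u != 0 -> u * v - w = u * (v - w / u).
      by move=> u0; rewrite mulrBr mulrCA divff ?mulr1.
    exact: cancel (mulf_neq0 pF (invr_neq0 (pivot_neq0 _ _))).
  by apply: local_partM Jq => //; exact: dehom_local.
exists (fun i => r i + r' i)%N => s les.
pose s' i := (s i - (r i + r' i))%N.
have -> : s = (fun i => (r i + r' i) + s' i)%N.
  by apply/funext => i; rewrite subnKC.
exists (p * q * pivot (j t) s'); split.
- by apply: mhomogMn (pivot_homog _ _); exact: mhomogMn.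
- by rewrite !dehomM dehom_pivot mulr1.
- move=> t' t't; rewrite !dehomM -mulrA mulrC.
  apply: local_partM => //; last exact: sep.
  by apply: local_partM => //; apply: dehom_local => //; exact: pivot_homog.
Qed.

End Points.

(** Lift a basis of each local quotient to forms p_u that vanish in the other
    local quotients. A combination of the p_u that lies in J vanishes in each
    local quotient, where it reads as a combination of the basis there. *)
Lemma independent_mod_ideal J delta :
  is_ideal J -> scheme_finite_of_degree J delta ->
  exists2 T : finType, #|T| = delta & exists r, forall s,
    (forall i, r i <= s i)%N -> exists2 p : T -> S,
      forall t, p t \in mhomog (dnat s) &
      forall c : T -> C, J (\sum_t c t *: p t) -> forall t, c t = 0.
Proof.
move=> JI [M [z [mu [zJ z_inj _ z_mult <-]]]].
have zP t : is_point (z t) by case: (zJ t).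
have [j zj] := fin_all_exists (fun t => pivot_exists (zP t)).
have [b bP] := fin_all_exists z_mult.
pose T : finType := {t : 'I_M & 'I_(mu t)}.
exists T.
  rewrite card_tagged sumnE big_map big_enum /=.
  by apply: eq_bigr => t _; rewrite card_ord.
have [r rP] := fin_all_exists (fun t : T =>
  simultaneous_approx JI zP zj z_inj z_mult ((bP (tag t)).1 (tagged t))).
exists (fun i => \sum_t r t i)%N => s les.
have /fin_all_exists[p pP] (t : T) : exists p, [/\ p \in mhomog (dnat s),
    local_part J (z (tag t)) (dehom (j (tag t)) s p - b (tag t) (tagged t)) &
    forall t', t' != tag t -> local_part J (z t') (dehom (j t') s p)].
  by apply: rP => i; apply: leq_trans (les i); rewrite (bigD1 t) //= leq_addr.
exists p => [t|c Jc [t e]]; first by case: (pP t).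
have hs : \sum_u c u *: p u \in mhomog (dnat s).
  by apply: rpred_sum => u _; apply: rpredZ; case: (pP u).
have := dehom_local (zj t) hs Jc.
have -> : dehom (j t) s (\sum_u c u *: p u)
    = \sum_u cst n (c u) * dehom (j t) s (p u).
  rewrite /dehom rmorph_sum mulr_suml; apply: eq_bigr => u _.
  by rewrite -mul_mpolyC rmorphM mulrA.
move=> Jsum.
have : local_part J (z t)
    (\sum_(u : T) cst n (c u) * (if tag u == t then b (tag u) (tagged u) else 0)).
  rewrite -[X in local_part _ _ X]subr0 -[X in _ - X](subrr
    (\sum_u cst n (c u) * dehom (j t) s (p u))).
  rewrite opprB addrCA; apply: local_partD => //.
  rewrite -sumrB; apply: local_part_sum => // u; rewrite -mulrBr.
  apply: local_partM (local_ring_cst _ _) _ => //.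
  have [_ pu pu'] := pP u; case: eqVneq => [ut|ut]; last first.
    by rewrite sub0r; apply/local_partN/pu' => //; rewrite eq_sym.
  by rewrite -ut -opprB; apply: local_partN.
rewrite (bigID (fun u : T => tag u == t)) /= [X in _ + X]big1 ?addr0; last first.
  by move=> u /negbTE ->; rewrite mulr0.
have -> : \sum_(u : T | tag u == t)
      cst n (c u) * (if tag u == t then b (tag u) (tagged u) else 0)
    = \sum_l cst n (c (Tagged (fun t => 'I_(mu t)) l)) * b t l.
  pose F t' l := cst n (c (Tagged (fun t => 'I_(mu t)) l)) * b t' l.
  transitivity (\sum_(t' | t' == t) \sum_l F t' l); last by rewrite big_pred1_eq.
  rewrite (@sig_big_dep _ _ _ _ (fun t => 'I_(mu t)) (pred1 t) (fun _ _ => true) F).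
  rewrite /F /=; apply: eq_big => [u|[t' l] /= ->] //; by rewrite andbT.
(* The zero class has the coordinates 0 as well as those given by c. *)
move=> Jb; have [] := (bP t).2 0 (local_part0 _ (is_idealT C n)).
move=> c0 [_ c0_uniq].
have c00 : c0 = 0.
  apply: c0_uniq; rewrite big1 ?subr0; first exact: local_part0.
  by move=> l _; rewrite mxE rmorph0 mul0r.
have /rowP/(_ e) : c0 = \row_l c (Tagged (fun t => 'I_(mu t)) l).
  apply: c0_uniq; rewrite sub0r; apply: local_partN => //.
  by under eq_bigr do rewrite mxE.
by rewrite c00 !mxE => <-.
Qed.

End Charts.
Lemma independent_family (C : fieldType) (k : nat) (n : 'I_k -> nat)
    (J : mring C n -> Prop) delta :
  is_ideal J -> scheme_finite_of_degree J delta ->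
  exists r : 'I_k -> nat, forall s, (forall i, r i <= s i)%N ->
    exists2 p : 'I_delta -> mring C n, forall t, p t \in mhomog (dnat s) &
      forall c : 'I_delta -> C, J (\sum_t c t *: p t) -> forall t, c t = 0.
Proof.
move=> JI /(independent_mod_ideal JI)[T cT [r rP]]; exists r => s /rP[p hp pI].
pose e i : T := enum_val (cast_ord (esym cT) i).
pose e' t := cast_ord cT (enum_rank (t : T)).
have eK : cancel e e' by move=> i; rewrite /e' /e enum_valK cast_ordKV.
have e'K : cancel e' e by move=> t; rewrite /e' /e cast_ordK enum_rankK.
exists (p \o e) => [t|c Jc t]; first exact: hp.
rewrite -[t]eK; apply: (pI (c \o e')).
rewrite (reindex e) /=; last by exists e' => x _.
by under eq_bigr do rewrite eK.
Qed.

(** * Multiplication by powers of h *)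

Section Truncated.
Context (C : fieldType) (k : nat) (n : 'I_k -> nat).
Local Notation S := (mring C n).
Context (s : nat) (f : 'I_s -> S) (delta : nat) (rho : 'I_k -> nat).
Context (N : 'Hom(Sdeg C n (dnat rho), 'rV[C]_delta)).
Context (a : forall i : 'I_k, 'rV[C]_(n i).+1).

Let F (p : S) := exists l, p = f l.
Let I := ideal_gen F.
Let K : S -> Prop := ideal_gen (fun p => exists2 v, v \in lker N & p = Sdeg_val v).
Let h : S := Sdeg_val (hprod a).

Hypothesis f_homog : forall l, exists d : 'I_k -> nat, f l \in mhomog (dnat d).
Hypothesis I_degree : scheme_finite_of_degree I delta.
Hypothesis kerN_I : (lker N <= Ideg F (dnat rho))%VS.
Hypothesis Nh_surj : limg (Nh N a) = fullv.

Let I_ideal : is_ideal I. Proof. exact: ideal_gen_is_ideal. Qed.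
Let K_ideal : is_ideal K. Proof. exact: ideal_gen_is_ideal. Qed.

Lemma idealZ J c (p : S) : is_ideal J -> J p -> J (c *: p).
Proof. by move=> [_ _ JM] Jp; rewrite -mul_mpolyC; exact: JM. Qed.

Lemma lker_K v : v \in lker N -> K (Sdeg_val v).
Proof. by move=> hv; apply: ideal_gen_mem; exists v. Qed.

Lemma K_sub_I p : K p -> I p.
Proof.
apply: ideal_gen_min I_ideal _ _ => _ [v vN ->].
exact/(IdegP F)/(subvP kerN_I).
Qed.

Lemma lker_hmul v : exists w, v - mul1 (hprod a) w \in lker N.
Proof.
have : N v \in limg (Nh N a) by rewrite Nh_surj memvf.
move=> /memv_imgP[w _ Nv]; exists w.
by rewrite memv_ker linearB /= Nv /Nh comp_lfunE /mulhom lfunE /= subrr.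
Qed.

(** By induction on m. A form of degree rho + (m+1).1 is a sum of products u v
    with v of degree rho; as v is h w modulo ker N, such a product is h (u w)
    modulo K, and u w has degree rho + m.1. *)
Lemma hpow_span m p : p \in mhomog (dnat (fun i => rho i + m)%N) ->
  exists g : Sdeg C n (dnat rho), K (p - h ^+ m * Sdeg_val g).
Proof.
have [K0 KD KM] := K_ideal.
elim: m p => [|m ih] p hp.
  have hp' : p \in mhomog (dnat rho).
    by apply: mhomog_eq hp => i; rewrite /dnat addn0.
  by exists (MkSdeg hp'); rewrite expr0 mul1r subrr.
have [q hq Kq] : exists2 q, q \in mhomog (dnat (fun i => rho i + m)%N) &
    K (p - h * q).
  pattern p; apply: (mhomog_mul_ind (r1 := fun=> m.+1) (r2 := rho) _ _ _ _ hp)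
    => [i||p1 p2 [q hq Kq] [q' hq' Kq']|u v hu hv].
  - exact: (congr1 Posz (addnC _ _)).
  - by exists 0; rewrite ?rpred0 // mulr0 subrr.
  - exists (q + q'); first exact: rpredD.
    by rewrite mulrDr opprD addrACA; exact: KD.
  - have [w] := lker_hmul (MkSdeg hv).
    move=> /lker_K Kw; exists (u * Sdeg_val w).
      apply: mhomogM hu (Sdeg_homog w) => i.
      by rewrite /dnat /dpred; lia.
    by rewrite mulrCA -mulrBr; exact: KM.
have [g Kg] := ih q hq; exists g.
have -> : p - h ^+ m.+1 * Sdeg_val g = (p - h * q) + h * (q - h ^+ m * Sdeg_val g).
  by rewrite mulrBr exprS mulrA subrKA.
by apply: KD => //; exact: KM.
Qed.

(** A dimension count in the degree rho + M.1: there are delta independent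
    classes modulo I there, they are represented by elements h^M w_t, and the
    images N w_t must then form a basis of C^delta. *)
Lemma hpow_inj m (g : Sdeg C n (dnat rho)) : I (h ^+ m * Sdeg_val g) -> g \in lker N.
Proof.
have [I0 ID IM] := I_ideal.
have [r rP] := independent_family I_ideal I_degree.
pose M := (m + \sum_i r i)%N.
have [|p hp pI] := rP (fun i => rho i + M)%N.
  by move=> i; rewrite /M (bigD1 i) //=; lia.
move=> Ig; have {}Ig : I (h ^+ M * Sdeg_val g).
  by rewrite /M addnC exprD -mulrA; exact: IM.
have [w wP] := fin_all_exists (fun t => hpow_span (hp t)).
pose A := \matrix_t N (w t).
have mulA u : u *m A = N (\sum_t u 0 t *: w t).
  rewrite mulmx_sum_row linear_sum; apply: eq_bigr => t _.
  by rewrite rowK linearZ.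
have sum0 (u : 'rV_delta) : I (h ^+ M * \sum_t u 0 t *: Sdeg_val (w t)) -> u = 0.
  move=> Iu; apply/rowP => t; rewrite mxE; move: t; apply: pI.
  have -> : \sum_t u 0 t *: p t = h ^+ M * (\sum_t u 0 t *: Sdeg_val (w t))
      + \sum_t u 0 t *: (p t - h ^+ M * Sdeg_val (w t)).
    rewrite mulr_sumr -big_split; apply: eq_bigr => t _ /=.
    by rewrite scalerBr scalerAr addrC subrK.
  apply: ID => //; apply: is_ideal_sum => // t; apply: idealZ => //.
  exact/K_sub_I/wP.
have valE (u : 'rV_delta) : Sdeg_val (\sum_t u 0 t *: w t)
    = \sum_t u 0 t *: Sdeg_val (w t).
  by rewrite -[LHS]/(val _) linear_sum; apply: eq_bigr => t _; rewrite linearZ.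
have uA : A \in unitmx.
  rewrite -row_free_unit; apply: inj_row_free => u; rewrite mulA => Nu.
  apply: sum0; rewrite -valE; apply/IM/K_sub_I/lker_K.
  by rewrite memv_ker Nu.
pose u := N g *m invmx A.
have Nu : N g = N (\sum_t u 0 t *: w t) by rewrite -mulA mulmxKV.
have u0 : u = 0.
  apply: sum0; rewrite -valE.
  have /lker_K/K_sub_I Id : g - \sum_t u 0 t *: w t \in lker N.
    by rewrite memv_ker linearB /= Nu subrr.
  have := is_ideal_sub I_ideal Ig (IM (h ^+ M) _ Id).
  by rewrite -mulrBr opprB addrC subrK.
rewrite memv_ker Nu u0 big1 ?linear0 // => t _; by rewrite mxE scale0r.
Qed.

Lemma Irho_ker v : (v \in Ideg F (dnat rho)) = (v \in lker N).
Proof.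
apply/idP/idP => [/IdegP Iv|]; last exact: (subvP kerN_I).
by apply: (@hpow_inj 0); rewrite expr0 mul1r.
Qed.


(** * The saturation of I as a colon ideal *)

(** A generator f_l of degree d is first multiplied by powers of the single h_i,
    with exponents rho_i + M - d_i, to reach the degree rho + M.1, where spanning
    and injectivity apply; the exponents are then made equal. *)
Lemma f_hpow l : exists m, K (h ^+ m * f l).
Proof.
have [_ KD KM] := K_ideal; have [d hd] := f_homog l.
pose M := (\sum_i d i)%N; pose e i := (rho i + M - d i)%N.
have leM i : (d i <= M)%N by rewrite /M (bigD1 i) //= leq_addr.
pose q := form_pow (linform a) e.
have hq : f l * q \in mhomog (dnat (fun i => rho i + M)%N).
  apply: mhomogM hd (form_pow_homog _ (linform_homog a)) => i.
  by rewrite /dnat /e; have := leM i; lia.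
have Kq : K (f l * q).
  have [g Kg] := hpow_span hq.
  have [_ ID IM] := I_ideal.
  have Iq : I (f l * q) by rewrite mulrC; apply: IM; apply: ideal_gen_mem; exists l.
  have /hpow_inj/lker_K Kg' : I (h ^+ M * Sdeg_val g).
    by have := is_ideal_sub I_ideal Iq (K_sub_I Kg); rewrite opprB addrC subrK.
  by rewrite -[X in K X](subrK (h ^+ M * Sdeg_val g)); apply: KD => //; exact: KM.
pose E := (\sum_i e i)%N; exists E.
have -> : h ^+ E = form_pow (linform a) (fun i => E - e i)%N * q.
  rewrite -form_powD /form_pow /h /= -prodrXl; apply: eq_bigr => i _.
  by rewrite subnK // /E (bigD1 i) //= leq_addr.
by rewrite -mulrA (mulrC q); exact: KM.
Qed.

Lemma I_hpow q : I q -> exists m, K (h ^+ m * q).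
Proof.
have [K0 KD KM] := K_ideal.
pose J p := exists m, K (h ^+ m * p).
apply: (@ideal_gen_min _ _ _ F J) => [|_ [l ->]]; last exact: f_hpow.
split=> [|p p' [m Km] [m' Km']|c p [m Km]].
- by exists 0%N; rewrite mulr0.
- exists (m + m')%N; rewrite mulrDr exprD -mulrA (mulrCA (h ^+ m)).
  by rewrite -[X in _ + X]mulrA; apply: KD; exact: KM.
- by exists m; rewrite mulrCA; exact: KM.
Qed.

Lemma hpow_homog l : h ^+ l \in mhomog (dnat (fun=> l)).
Proof.
by apply: mhomog_eq (mhomogX l (Sdeg_homog (hprod a))) => i; rewrite /dones natz.
Qed.

(** If h^l q is in K, then a form p of degree at least rho + l.1 in every
    direction is a sum of products u (h^l g + r) with r in K, so p q is in I. *)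
Lemma saturation_colon q : saturation I q <-> colon_star K h q.
Proof.
have [_ ID IM] := I_ideal; split=> [[l Iq]|[l Kq]].
  have [m Km] := I_hpow (Iq _ (hpow_homog l)).
  by exists (m + l)%N; rewrite exprD -mulrA.
exists (l + \sum_i rho i)%N => p hp.
(* Degree (l + sum of rho_i).1 exceeds rho + l.1 in every direction, by [r1]. *)
pose r1 i := (\sum_l rho l - rho i)%N.
pose r2 i := (rho i + l)%N.
pattern p; apply: (mhomog_mul_ind (r1 := r1) (r2 := r2) _ _ _ _ hp)
  => [i||p1 p2|u v hu hv].
- rewrite /dnat /r1 /r2; congr Posz.
  have : (rho i <= \sum_l rho l)%N by rewrite (bigD1 i) //= leq_addr.
  by move: (\sum_l _)%N => z; lia.
- by rewrite mul0r; case: I_ideal.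
- by rewrite mulrDl; exact: ID.
- have [g Kg] := hpow_span hv; rewrite -mulrA; apply: (IM).
  rewrite -[v](subrK (h ^+ l * Sdeg_val g)) mulrDl; apply: ID.
    by rewrite mulrC; exact: IM (K_sub_I Kg).
  by rewrite mulrAC mulrC; exact: IM (K_sub_I Kq).
Qed.

(** * The complement B and the multiplication operators *)

Section Complement.
Context (B : {vspace Sdeg C n (dpred rho)}).
Hypothesis B_span : (B + lker (Nh N a))%VS = fullv.
Hypothesis B_direct : directv (B + lker (Nh N a)).

Lemma NhE w : Nh N a w = N (mul1 (hprod a) w).
Proof. by rewrite /Nh comp_lfunE /mulhom lfunE. Qed.

Lemma NstarE b : Nstar N a B b = N (mul1 (hprod a) (vsval b)).
Proof. by rewrite /Nstar comp_lfunE NhE lfunE. Qed.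

Lemma Nstar_ker : lker (Nstar N a B) == 0%VS.
Proof.
apply/eqP/vspaceP => b; rewrite memv_ker memv0; apply/eqP/eqP => [|->]; last exact: linear0.
move=> Nb; apply/val_inj/eqP; rewrite -memv0.
have /directv_addP <- := B_direct; rewrite memv_cap memv_ker.
by apply/andP; split; [exact: subvsP | rewrite NhE -NstarE Nb].
Qed.

Lemma Nstar_surj y : exists b, Nstar N a B b = y.
Proof.
have : y \in limg (Nh N a) by rewrite Nh_surj memvf.
move=> /memv_imgP[w _ ->].
have /memv_addP[b bB [v /[!memv_ker] /eqP Nv ->]] : w \in (B + lker (Nh N a))%VS.
  by rewrite B_span memvf.
by exists (vsproj B b); rewrite linearD /= [X in _ + X]Nv addr0 NstarE vsprojK // NhE.
Qed.

Definition Nstar_inv := (Nstar N a B)^-1%VF.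

Lemma NstarK : cancel (Nstar N a B) Nstar_inv.
Proof. exact: lker0_lfunK Nstar_ker. Qed.

Lemma Nstar_invK : cancel Nstar_inv (Nstar N a B).
Proof. by move=> y; have [b <-] := Nstar_surj y; rewrite NstarK. Qed.

Lemma hB_rep v :
  v - mul1 (hprod a) (vsval (Nstar_inv (N v))) \in Ideg F (dnat rho).
Proof. by rewrite Irho_ker memv_ker linearB /= -NstarE Nstar_invK subrr. Qed.

Lemma hB_inj (b : subvs_of B) :
  mul1 (hprod a) (vsval b) \in Ideg F (dnat rho) -> b = 0.
Proof.
rewrite Irho_ker memv_ker -NstarE => /eqP Nb.
by rewrite -[b]NstarK Nb linear0.
Qed.

Lemma hBP v :
  reflect (exists b : subvs_of B, v = mul1 (hprod a) (vsval b)) (v \in hB a B).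
Proof.
apply: (iffP memv_imgP) => [[b bB ->]|[b ->]].
  by exists (vsproj B b); rewrite vsprojK // /mulhom lfunE.
by exists (vsval b); [exact: subvsP | rewrite /mulhom lfunE].
Qed.

Lemma hB_span : (hB a B + Ideg F (dnat rho))%VS = fullv.
Proof.
apply/vspaceP => v; rewrite memvf; have := hB_rep v; set b := vsval _ => Iv.
rewrite -[v](subrK (mul1 (hprod a) b)) addrC; apply: memv_add => //.
by apply/hBP; exists (Nstar_inv (N v)).
Qed.

Lemma hB_direct : directv (hB a B + Ideg F (dnat rho)).
Proof.
apply/directv_addP/vspaceP => v; rewrite memv_cap memv0.
apply/andP/eqP => [[/hBP[b ->] /hB_inj ->]|->]; last by rewrite !mem0v.
by rewrite !linear0.
Qed.

Definition mult_map i (j : 'I_(n i).+1) : 'End(subvs_of B) :=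
  (Nstar_inv \o Nij N a B j)%VF.

Lemma NijE i (j : 'I_(n i).+1) b : Nij N a B j b = N (mul1 (hxprod a j) (vsval b)).
Proof. by rewrite /Nij !comp_lfunE /mulhom !lfunE. Qed.

Lemma mult_map_Nij i (j : 'I_(n i).+1) b :
  mult_map j b = Nstar_inv (Nij N a B j b).
Proof. exact: comp_lfunE. Qed.

Lemma mult_mapE i (j : 'I_(n i).+1) b :
  mul1 (hprod a) (vsval (mult_map j b)) - mul1 (hxprod a j) (vsval b)
    \in Ideg F (dnat rho).
Proof.
by rewrite Irho_ker memv_ker linearB /= -NstarE mult_map_Nij Nstar_invK NijE subrr.
Qed.

(** Applying both products to b and multiplying by h^2 gives
    (h x_ij / h_i) (h x_i'j' / h_i') b modulo I, in either order. The difference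
    is h times an element of h B, and [hpow_inj] cancels h. *)
Lemma mult_map_comm i (j : 'I_(n i).+1) i' (j' : 'I_(n i').+1) :
  (mult_map j \o mult_map j' = mult_map j' \o mult_map j)%VF.
Proof.
have [_ ID IM] := I_ideal.
apply/lfunP => b; rewrite [LHS]comp_lfunE [RHS]comp_lfunE; apply: subr0_eq.
apply: hB_inj; rewrite Irho_ker; apply: (hpow_inj (m := 1)).
set u := mult_map j _; set u' := mult_map j' _.
have E1 := (IdegP F _).1 (mult_mapE j (mult_map j' b)).
have E2 := (IdegP F _).1 (mult_mapE j' b).
have E3 := (IdegP F _).1 (mult_mapE j' (mult_map j b)).
have E4 := (IdegP F _).1 (mult_mapE j b).
pose X : S := Sdeg_val (hxprod a j); pose X' : S := Sdeg_val (hxprod a j').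
pose w := Sdeg_val (vsval (mult_map j' b)); pose w' := Sdeg_val (vsval (mult_map j b)).
pose c := Sdeg_val (vsval b).
have D1 : I (h * (h * Sdeg_val (vsval u) - X * w) + X * (h * w - X' * c)).
  by apply: ID; exact: IM.
have D2 : I (h * (h * Sdeg_val (vsval u') - X' * w') + X' * (h * w' - X * c)).
  by apply: ID; exact: IM.
have -> : Sdeg_val (mul1 (hprod a) (vsval (u - u')))
    = h * Sdeg_val (vsval u) - h * Sdeg_val (vsval u').
  by rewrite -mulrBr.
(* y = h; x, x' are the two h x_ij / h_i; z = b; t, t' are its images under the
   two operators, and v, v' those under their two products. *)
have cancel (A : comPzRingType) (y x x' t t' z v v' : A) :
    y * (y * v - x * t) + x * (y * t - x' * z)
      - (y * (y * v' - x' * t') + x' * (y * t' - x * z)) = y ^+ 1 * (y * v - y * v').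
  by ring.
have := is_ideal_sub I_ideal D1 D2; congr I; exact: cancel.
Qed.

(** * The action of the affine coordinate ring *)

Section Action.
Implicit Types (x y : S_frac C n) (g : Sdeg C n (dnat rho)).

(** The multiplication by x sends the class of g to that of g'. It is stated as a
    relation because the expression of x as a fraction P / h^m is not unique. *)
Definition acts_as x g g' := exists m (P : S),
  [/\ P \in mhomog (dnat (fun=> m)), x * toS_frac (h ^+ m) = toS_frac P &
      I (h ^+ m * Sdeg_val g' - P * Sdeg_val g)].

Hypothesis h_neq0 : forall i, linform a i <> 0.

Lemma hprod_xfrac i (j : 'I_(n i).+1) :
  xfrac a j * toS_frac h = toS_frac (Sdeg_val (hxprod a j)).
Proof.
rewrite /xfrac /h /= (bigD1 i) //= !rmorphM mulrA divfK //.
by apply/toS_frac_neq0/eqP.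
Qed.

Lemma in_affine_num x : in_affine a x ->
  exists m (P : S),
    P \in mhomog (dnat (fun=> m)) /\ x * toS_frac (h ^+ m) = toS_frac P.
Proof.
elim=> {x} [c|i j|x y _ [m [P [hP xP]]] _ [m' [P' [hP' yP]]]
    |x y _ [m [P [hP xP]]] _ [m' [P' [hP' yP]]]].
- exists 0%N, c%:MP; rewrite expr0 rmorph1 mulr1; split=> //; exact: mhomogC.
- exists 1%N, (Sdeg_val (hxprod a (lift ord0 j))); rewrite expr1 hprod_xfrac.
  by split=> //; exact: Sdeg_homog.
- exists (m + m')%N, (P * h ^+ m' + h ^+ m * P'); split.
    apply: rpredD; first exact: mhomogMn hP (hpow_homog m').
    exact: mhomogMn (hpow_homog m) hP'.
  rewrite mulrDl exprD rmorphM rmorphD !rmorphM /= -xP -yP; ring.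
- exists (m + m')%N, (P * P'); split; first exact: mhomogMn hP hP'.
  rewrite exprD !rmorphM /= -xP -yP; ring.
Qed.

Lemma acts_as_exists x g : in_affine a x -> exists g', acts_as x g g'.
Proof.
move=> /in_affine_num[m [P [hP xP]]].
have [|g' Kg'] := @hpow_span m (P * Sdeg_val g).
  by apply: mhomogM hP (Sdeg_homog g) => i; rewrite /dnat addrC.
exists g', m, P; split=> //.
by rewrite -opprB -mulN1r; have [_ _ IM] := I_ideal; apply/IM/K_sub_I.
Qed.

Lemma num_unique x m m' (P P' : S) :
  x * toS_frac (h ^+ m) = toS_frac P -> x * toS_frac (h ^+ m') = toS_frac P' ->
  h ^+ m' * P = h ^+ m * P'.
Proof.
move=> xP xP'; apply/eqP; rewrite -tofrac_eq; apply/eqP.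
rewrite -[LHS]/(toS_frac _) -[RHS]/(toS_frac _) !rmorphM /= -xP -xP'; ring.
Qed.

(** Cross-multiplying two expressions P / h^m and P' / h^m' of x shows that
    h^(m+m') (g1' - g2') lies in I, and [hpow_inj] cancels the power of h. *)
Lemma acts_as_uniq x g1 g1' g2 g2' :
  acts_as x g1 g1' -> acts_as x g2 g2' ->
  g1 - g2 \in Ideg F (dnat rho) -> g1' - g2' \in Ideg F (dnat rho).
Proof.
have [_ ID IM] := I_ideal.
move=> [m [P [_ xP I1]]] [m' [P' [_ xP' I2]]] /IdegP I12.
have PP' := num_unique xP xP'.
rewrite Irho_ker; apply: (hpow_inj (m := m + m')).
have := ID _ _ (is_ideal_sub I_ideal (IM (h ^+ m') _ I1) (IM (h ^+ m) _ I2))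
  (IM (h ^+ m * P') _ I12).
congr I; rewrite -[Sdeg_val (g1 - g2)]/(Sdeg_val g1 - Sdeg_val g2).
rewrite -[Sdeg_val (g1' - g2')]/(Sdeg_val g1' - Sdeg_val g2') exprD.
have -> : h ^+ m' * (h ^+ m * Sdeg_val g1' - P * Sdeg_val g1)
    = h ^+ m' * (h ^+ m * Sdeg_val g1') - h ^+ m * P' * Sdeg_val g1.
  by rewrite mulrBr mulrA mulrA PP'.
ring.
Qed.

Lemma acts_asDl x y g g1 g2 :
  acts_as x g g1 -> acts_as y g g2 -> acts_as (x + y) g (g1 + g2).
Proof.
have [_ ID IM] := I_ideal.
move=> [m [P [hP xP I1]]] [m' [P' [hP' yP I2]]].
exists (m + m')%N, (P * h ^+ m' + h ^+ m * P'); split.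
- apply: rpredD; first exact: mhomogMn hP (hpow_homog m').
  exact: mhomogMn (hpow_homog m) hP'.
- rewrite exprD rmorphD !rmorphM /= -xP -yP; ring.
- have := ID _ _ (IM (h ^+ m') _ I1) (IM (h ^+ m) _ I2); congr I.
  rewrite -[Sdeg_val (g1 + g2)]/(Sdeg_val g1 + Sdeg_val g2) exprD; ring.
Qed.

Lemma acts_asDr x g1 g1' g2 g2' :
  acts_as x g1 g1' -> acts_as x g2 g2' -> acts_as x (g1 + g2) (g1' + g2').
Proof.
have [_ ID IM] := I_ideal.
move=> [m [P [hP xP I1]]] [m' [P' [hP' xP' I2]]].
have PP' := num_unique xP xP'.
exists (m + m')%N, (h ^+ m' * P); split.
- by rewrite mulrC; exact: mhomogMn hP (hpow_homog m').
- rewrite exprD !rmorphM /= -xP; ring.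
- have := ID _ _ (IM (h ^+ m') _ I1) (IM (h ^+ m) _ I2); congr I.
  rewrite -[Sdeg_val (g1 + g2)]/(Sdeg_val g1 + Sdeg_val g2).
  rewrite -[Sdeg_val (g1' + g2')]/(Sdeg_val g1' + Sdeg_val g2') exprD.
  have -> : h ^+ m * (h ^+ m' * Sdeg_val g2' - P' * Sdeg_val g2)
      = h ^+ m * (h ^+ m' * Sdeg_val g2') - h ^+ m' * P * Sdeg_val g2.
    by rewrite mulrBr [X in _ - X]mulrA PP'.
  ring.
Qed.

Lemma acts_asM x y g g1 g2 :
  acts_as y g g1 -> acts_as x g1 g2 -> acts_as (x * y) g g2.
Proof.
have [_ ID IM] := I_ideal.
move=> [m [P [hP yP I1]]] [m' [P' [hP' xP I2]]].
exists (m + m')%N, (P * P'); split; first exact: mhomogMn hP hP'.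
  rewrite exprD !rmorphM /= -xP -yP; ring.
have := ID _ _ (IM P' _ I1) (IM (h ^+ m) _ I2); congr I.
rewrite exprD; ring.
Qed.

Lemma acts_as_cst c g : acts_as (cst n c) g (c *: g).
Proof.
exists 0%N, c%:MP; rewrite expr0 rmorph1 mulr1; split=> //; first exact: mhomogC.
rewrite mul1r mul_mpolyC -[Sdeg_val (c *: g)]/(c *: Sdeg_val g) subrr.
by case: I_ideal.
Qed.

Lemma acts_as_xfrac i (j : 'I_(n i).+1) b :
  acts_as (xfrac a j) (mul1 (hprod a) b) (mul1 (hxprod a j) b).
Proof.
exists 1%N, (Sdeg_val (hxprod a j)); rewrite expr1 hprod_xfrac; split=> //.
  exact: Sdeg_homog.
rewrite -[Sdeg_val (mul1 (hprod a) b)]/(h * Sdeg_val b).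
rewrite -[Sdeg_val (mul1 (hxprod a j) b)]/(Sdeg_val (hxprod a j) * Sdeg_val b).
by rewrite mulrCA subrr; case: I_ideal.
Qed.

Local Notation Q := (Squot F (dnat rho)).

Lemma Sclass_eq g g' : g - g' \in Ideg F (dnat rho) <-> Sclass F g = Sclass F g'.
Proof. by rewrite Quotient.idealrBE; split=> [/eqP|/eqP]. Qed.

Lemma SclassD g g' : Sclass F (g + g') = Sclass F g + Sclass F g'.
Proof. by rewrite /Sclass; exact: raddfD. Qed.

Lemma Sclass_surj (v : Q) : exists g, v = Sclass F g.
Proof. by exists (repr v); rewrite /Sclass reprK. Qed.

Lemma acts_as_total (x : affine_ring a) g : exists g', acts_as (affine_val x) g g'.
Proof. by apply: acts_as_exists; case: x => x hx; exact/asboolP. Qed.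

Lemma quot_action_exists (x : affine_ring a) (v : Q) :
  exists w : Q, forall g g', v = Sclass F g -> acts_as x g g' -> w = Sclass F g'.
Proof.
have [g ->] := Sclass_surj v.
have [g' gg'] := acts_as_total x g.
exists (Sclass F g') => g1 g1' /Sclass_eq gg1 g1g1'.
exact/Sclass_eq/(acts_as_uniq gg' g1g1').
Qed.

Definition quot_action (x : affine_ring a) (v : Q) : Q :=
  sval (cid (quot_action_exists x v)).

Lemma quot_actionE (x : affine_ring a) g g' :
  acts_as (affine_val x) g g' -> quot_action x (Sclass F g) = Sclass F g'.
Proof. by rewrite /quot_action; case: cid => w /= wP; exact: wP. Qed.

Lemma quot_action_module : module_action quot_action.
Proof.
split=> [x y v|v|x v w|x y v]; have [g ->] := Sclass_surj v.
- have [g1 gg1] := acts_as_total y g; have [g2 g1g2] := acts_as_total x g1.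
  rewrite (quot_actionE gg1) (quot_actionE g1g2).
  by rewrite (quot_actionE (x := x * y) (acts_asM gg1 g1g2)).
- rewrite -[g in RHS]scale1r; apply: (quot_actionE (x := 1)).
  by have := acts_as_cst 1 g; rewrite rmorph1.
- have [g' ->] := Sclass_surj w.
  have [g1 gg1] := acts_as_total x g; have [g2 g'g2] := acts_as_total x g'.
  rewrite -SclassD (quot_actionE gg1) (quot_actionE g'g2) -SclassD.
  exact/quot_actionE/acts_asDr.
- have [g1 gg1] := acts_as_total x g; have [g2 gg2] := acts_as_total y g.
  rewrite (quot_actionE gg1) (quot_actionE gg2) -SclassD.
  exact: (quot_actionE (x := x + y) (acts_asDl gg1 gg2)).
Qed.

Definition hB_class (u : subvs_of (hB a B)) : Q := Sclass F (vsval u).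

Lemma hB_class_zmod : zmod_morphism hB_class.
Proof. by move=> u v; rewrite /hB_class linearB /Sclass; exact: raddfB. Qed.

HB.instance Definition _ :=
  GRing.isZmodMorphism.Build (subvs_of (hB a B)) Q hB_class hB_class_zmod.

(** The preimage of a class is found with N^*: it is h b, where b in B has the
    same image under N_h as the class has under N. *)
Definition hB_lift (v : Q) : subvs_of (hB a B) :=
  vsproj (hB a B) (mul1 (hprod a) (vsval (Nstar_inv (N (repr v))))).

Lemma hB_liftK : cancel hB_lift hB_class.
Proof.
move=> v; rewrite /hB_class /hB_lift vsprojK; last by apply/hBP; eexists.
rewrite -[RHS]reprK; apply/esym/Sclass_eq; exact: hB_rep.
Qed.

Lemma hB_class_inj : injective hB_class.
Proof.
move=> u v /Sclass_eq; rewrite -linearB => Iuv; apply/eqP; rewrite -subr_eq0.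
have /directv_addP/vspaceP/(_ (vsval (u - v))) := hB_direct.
by rewrite memv_cap subvsP Iuv memv0 => /esym/eqP e; apply/eqP/val_inj.
Qed.

Lemma hB_classK : cancel hB_class hB_lift.
Proof. by move=> u; apply: hB_class_inj; rewrite hB_liftK. Qed.

(** The action on h B is the one that makes [hB_class] an isomorphism of
    modules. *)
Definition hB_action (x : affine_ring a) (u : subvs_of (hB a B)) :=
  hB_lift (quot_action x (hB_class u)).

Lemma hB_class_action (x : affine_ring a) u :
  hB_class (hB_action x u) = quot_action x (hB_class u).
Proof. exact: hB_liftK. Qed.

Lemma hB_action_module : module_action hB_action.
Proof.
have [QM Q1 QDr QDl] := quot_action_module.
split=> [x y u|u|x u v|x y u]; apply: hB_class_inj.
- by rewrite !hB_class_action QM.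
- by rewrite hB_class_action Q1.
- by rewrite raddfD /= !hB_class_action raddfD /= QDr.
- by rewrite raddfD /= !hB_class_action QDl.
Qed.

End Action.
End Complement.
End Truncated.

Theorem theorem6p1 (R : realType) (k : nat) (n : 'I_k -> nat)
    (s : nat) (f : 'I_s -> mring R[i] n) (delta : nat) (rho : 'I_k -> nat)
    (N : 'Hom(Sdeg R[i] n (dnat rho), 'rV[R[i]]_delta))
    (a : forall i : 'I_k, 'rV[R[i]]_(n i).+1)
    (B : {vspace Sdeg R[i] n (dpred rho)}) :
  let F := fun p => exists l, p = f l in
  let I := ideal_gen F in
  let I_rho := Ideg F (dnat rho) in
  let h := hprod a in
  (forall l, exists d : 'I_k -> nat, f l \in mhomog (dnat d)) ->
  scheme_finite_of_degree I delta ->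
  limg N = fullv ->
  (lker N <= I_rho)%VS ->
  (forall i, linform a i <> 0) ->
  limg (Nh N a) = fullv ->
  (B + lker (Nh N a))%VS = fullv -> directv (B + lker (Nh N a)) ->
  [/\ (* (i) *)
      bijective (Nstar N a B),
      (* (ii) *)
      exists (actB : affine_ring a -> subvs_of (hB a B) -> subvs_of (hB a B))
             (actQ : affine_ring a -> Squot F (dnat rho) -> Squot F (dnat rho))
             (phi : {additive subvs_of (hB a B) -> Squot F (dnat rho)}),
        [/\ module_action actB
              /\ (forall c u, actB (affine_cst a c) u = c *: u)
              /\ (forall i (j : 'I_(n i)) b u, b \in B ->
                    vsval u = mul1 h b ->
                    vsval (actB (affine_var a j) u)
                      - mul1 (hxprod a (lift ord0 j)) b \in I_rho),
            module_action actQ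
              /\ (forall c v, actQ (affine_cst a c) (Sclass F v)
                              = Sclass F (c *: v))
              /\ (forall i (j : 'I_(n i)) g,
                    actQ (affine_var a j) (Sclass F (mul1 h g))
                      = Sclass F (mul1 (hxprod a (lift ord0 j)) g)),
            bijective phi &
            forall x u, phi (actB x u) = actQ x (phi u)],
      (* (iii) *)
      [/\ (hB a B + I_rho)%VS = fullv,
          directv (hB a B + I_rho) &
          let K := ideal_gen (fun p => exists2 v, v \in lker N & p = Sdeg_val v) in
          (forall q, saturation I q <-> colon_star K (Sdeg_val h) q) /\
          ((forall q, saturation I q -> I q) ->
            forall q, I q <-> colon_star K (Sdeg_val h) q)] &
      (* (iv) *)
      exists m : forall i : 'I_k, 'I_(n i).+1 -> 'End(subvs_of B),
        [/\ forall i j, Nij N a B j = (Nstar N a B \o m i j)%VF,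
            forall i j b, mul1 h (vsval (m i j b)) - mul1 (hxprod a j) (vsval b)
                          \in I_rho &
            forall i j i' j', (m i j \o m i' j' = m i' j' \o m i j)%VF]].
Proof.
move=> F I I_rho h f_homog I_degree N_surj kerN_I h_neq0 Nh_surj B_span B_direct.
split.
- exists (Nstar_inv N a B); first exact: (NstarK B_direct).
  exact: (Nstar_invK Nh_surj B_span B_direct).
- have classK := hB_classK I_degree kerN_I Nh_surj B_span B_direct.
  have liftK := hB_liftK I_degree kerN_I Nh_surj B_span B_direct.
  pose actB := hB_action I_degree kerN_I Nh_surj (B := B) h_neq0.
  pose actQ := quot_action I_degree kerN_I Nh_surj h_neq0.
  have classE x u : hB_class f (actB x u) = actQ x (hB_class f u) by exact: liftK.
  have actQ_cst c v : actQ (affine_cst a c) (Sclass F v) = Sclass F (c *: v).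
    by apply: quot_actionE; exact: acts_as_cst.
  have actQ_var i (j : 'I_(n i)) g : actQ (affine_var a j) (Sclass F (mul1 h g))
      = Sclass F (mul1 (hxprod a (lift ord0 j)) g).
    by apply: quot_actionE; exact: acts_as_xfrac.
  exists actB, actQ, (@hB_class _ _ _ _ f rho a B); split=> //.
  + split; first exact: hB_action_module.
    split=> [c u|i j b u bB uE].
      by apply: (can_inj classK); rewrite classE actQ_cst /hB_class linearZ.
    apply/(Sclass_eq f); rewrite -[LHS]/(hB_class f _) classE /hB_class uE.
    exact: actQ_var.
  + by split; first exact: quot_action_module.
  + by exists (hB_lift N a B).
- split.
  + exact: (hB_span I_degree kerN_I Nh_surj B_span B_direct).
  + exact: (hB_direct I_degree kerN_I Nh_surj B_direct).
  + have satE := saturation_colon f_homog I_degree kerN_I Nh_surj.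
    move=> K; split=> [q|satI q]; first exact: satE.
    split=> [Iq|/satE]; last exact: satI.
    by apply/satE; exists 0%N => p _; case: (ideal_gen_is_ideal F) => _ _; exact.
- exists (fun i j => mult_map N a B j); split=> [i j|i j b|i j i' j'].
  + apply/lfunP => b; rewrite [RHS]comp_lfunE mult_map_Nij.
    by rewrite (Nstar_invK Nh_surj B_span B_direct).
  + exact: (mult_mapE I_degree kerN_I Nh_surj B_span B_direct).
  + exact: (mult_map_comm I_degree kerN_I Nh_surj B_span B_direct).
Qed.
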